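(* Let $(\mathcal{S},\mathcal{A},p_{\mathrm{tr}},d_{\varnothing},\gamma)$ be a finite discounted MDP with $\gamma\in[0,1)$, let $\mathcal{R}$ be a probability distribution over reward functions $\mathcal{S}\times\mathcal{A}\times\mathcal{S}\to[-U,U]$, let $1\le k\le N$ and $T\ge1$ be integers, and let $(\pi^t)_{t=1}^T$ be the random sequence of stationary policies generated by $k$-of-$N$ CFR with per-state regret bound $C^T$. Then for every stationary policy $\pi$ and every $p\in(0,1]$, with probability at least $1-p$, the full regret of $k$-of-$N$ CFR with respect to $\pi$ satisfies $$\sum_{t=1}^T\Bigl(\mathbb{E}_{\bar r\sim\mu_{k\text{-of-}N}(\cdot;\pi)}\bigl[v_{\varnothing}(\pi;\bar r)\bigr]-\mathbb{E}_{\bar r\sim\mu_{k\text{-of-}N}(\cdot;\pi^t)}\bigl[v_{\varnothing}(\pi^t;\bar r)\bigr]\Bigr)\le\frac{C^T}{1-\gamma}+4U\sqrt{2T\log(1/p)}.$$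
   Context: MDP. $\mathcal{S}$ is a finite set of states, $\mathcal{A}$ a finite set of actions, $p_{\mathrm{tr}}(\cdot\mid s,a)$ a probability distribution on $\mathcal{S}$ for each $(s,a)$ (Markovian transitions), $d_{\varnothing}$ an initial state distribution on $\mathcal{S}$, $\gamma\in[0,1)$ a discount factor. The transition probabilities and initial distribution are fixed and known; only the reward function is uncertain. A reward function is a map $r:\mathcal{S}\times\mathcal{A}\times\mathcal{S}\to[-U,U]$. A stationary policy $\pi$ assigns to each state $s$ a probability distribution $\pi(\cdot\mid s)$ on $\mathcal{A}$. Returns (normalized by $1-\gamma$). With $A_i\sim\pi(\cdot\mid S_{i-1})$ and $S_i\sim p_{\mathrm{tr}}(\cdot\mid S_{i-1},A_i)$ for $i\ge1$: $v_{\varnothing}(\pi;r)=(1-\gamma)\,\mathbb{E}\bigl[\sum_{i=0}^\infty\gamma^i r(S_i,A_{i+1},S_{i+1})\bigr]$ with $S_0\sim d_{\varnothing}$; $q_s(a,\pi;r)=(1-\gamma)\,\mathbb{E}\bigl[\sum_{i=0}^\infty\gamma^i r(S_i,A_{i+1},S_{i+1})\mid S_0=s,A_1=a\bigr]$ (take $a$ first, follow $\pi$ afterwards); $v_s(\pi;r)=\mathbb{E}_{A\sim\pi(\cdot\mid s)}[q_s(A,\pi;r)]$; advantage $\rho_s(a,\pi;r)=q_s(a,\pi;r)-v_s(\pi;r)$. CFR. Given reward functions $r^1,r^2,\dots$ revealed one at a time, CFR deterministically produces stationary policies $\pi^1,\pi^2,\dots$, where $\pi^t$ depends only on $r^1,\dots,r^{t-1}$,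 by running a no-regret learner at each state $s$, which generates $\pi^t(\cdot\mid s)$ and then learns from $q_s(\cdot,\pi^t;r^t)$. Its defining property is that, for every sequence of reward functions (possibly chosen adaptively, with $r^t$ depending on $\pi^t$), $\sum_{t=1}^T\rho_s(a,\pi^t;r^t)\le C^T$ for all $s\in\mathcal{S}$, $a\in\mathcal{A}$, where $C^T\in o(T)$ is a deterministic bound depending on the learner used. $k$-of-$N$ distribution. For a stationary policy $\pi$, $\mu_{k\text{-of-}N}(\cdot;\pi)$ is the distribution of the random reward function $\bar r=\frac1k\sum_{j=1}^k r_{(j)}$, where $r_1,\dots,r_N$ are drawn i.i.d. from $\mathcal{R}$ and $r_{(1)},\dots,r_{(N)}$ is their reordering by increasing value of $v_{\varnothing}(\pi;\cdot)$ (so $r_{(1)},\dots,r_{(k)}$ are the $k$ worst for $\pi$; ties broken by a fixed rule). $k$-of-$N$ CFR. On iteration $t$, given the current policy $\pi^t$, sample $N$ fresh reward functions i.i.d. from $\mathcal{R}$ independently of the past, form $\bar r^t$ as the average of the $k$ worst ones for $\pi^t$ (so that, given the past, $\bar r^t\sim\mu_{k\text{-of-}N}(\cdot;\pi^t)$), and feed $r^t:=\bar r^t$ to CFR to obtain $\pi^{t+1}$. In the regret, the expectation with respect to $\mu_{k\text{-of-}N}(\cdot;\pi^t)$ is over a fresh $\bar r$ with $\pi^t$ held fixed, so the regret is a random variable through $(\pi^t)_{t=1}^T$. *)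

(* Defs.v *)
From HB Require Import structures.
From mathcomp Require Import all_boot all_order all_algebra perm.
From mathcomp Require Import all_classical all_reals all_analysis.
From mathcomp Require Import ring lra.

Set Implicit Arguments.
Unset Strict Implicit.
Unset Printing Implicit Defensive.

Import Order.TTheory GRing.Theory Num.Theory.
Import numFieldNormedType.Exports.

Local Open Scope classical_set_scope.
Local Open Scope ring_scope.

Record fdist (R : realType) (X : finType) := FDist {
  fdist_fun :> X -> R ;
  fdist_ge0 : forall x, 0 <= fdist_fun x ;
  fdist_sum1 : \sum_x fdist_fun x = 1 }.

Section fdist_constructions.
Context {R : realType}.

Lemma fdist1_ge0 (X : finType) (x0 x : X) : 0 <= (x == x0)%:R :> R.
Proof. exact: ler0n. Qed.

Lemma fdist1_sum1 (X : finType) (x0 : X) : \sum_x (x == x0)%:R = 1 :> R.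
Proof.
rewrite (bigD1 x0) //= eqxx big1 ?addr0 // => x /negbTE -> //.
Qed.

Definition fdist1 (X : finType) (x0 : X) : fdist R X :=
  FDist (fdist1_ge0 x0) (fdist1_sum1 x0).

Context (X Y : finType) (d : fdist R X) (k : X -> fdist R Y).

Lemma fdist_pair_ge0 (z : X * Y) : 0 <= d z.1 * k z.1 z.2.
Proof. by rewrite mulr_ge0 ?fdist_ge0. Qed.

Lemma fdist_pair_sum1 : \sum_z d z.1 * k z.1 z.2 = 1.
Proof.
rewrite -(pair_bigA _ (fun x y => d x * k x y)) /= -[RHS](fdist_sum1 d).
by apply: eq_bigr => x _; rewrite -big_distrr /= fdist_sum1 mulr1.
Qed.

(* The joint law of (x, y) with x ~ d and y ~ k x. *)
Definition fdist_pair : fdist R (X * Y)%type :=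
  FDist fdist_pair_ge0 fdist_pair_sum1.

End fdist_constructions.

(* R-valued functions on a finite type, with the product Borel sigma-algebra,
   that is, the one generated by the evaluations. *)
Definition rvec (R : realType) (X : finType) : Type := X -> R.

Definition rvec_display : measure_display.
Proof. by constructor. Qed.

Section rvec_measurable.
Context (R : realType) (X : finType).

HB.instance Definition _ := gen_eqMixin (rvec R X).
HB.instance Definition _ := gen_choiceMixin (rvec R X).
HB.instance Definition _ := isPointed.Build (rvec R X) (fun=> 0).

Definition rvec_measurable : set (set (rvec R X)) :=
  <<s \bigcup_(x in [set: X])
        preimage_set_system setT (fun f : rvec R X => f x) measurable >>.

Let rvec_measurable0 : rvec_measurable set0.
Proof. exact: sigma_algebra0. Qed.

Let rvec_measurableC A : rvec_measurable A -> rvec_measurable (~` A).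
Proof. exact: sigma_algebraC. Qed.

Let rvec_measurable_bigcup (F : (set (rvec R X))^nat) :
  (forall i, rvec_measurable (F i)) -> rvec_measurable (\bigcup_i F i).
Proof. exact: sigma_algebra_bigcup. Qed.

HB.instance Definition _ := @isMeasurable.Build rvec_display (rvec R X)
  rvec_measurable rvec_measurable0 rvec_measurableC rvec_measurable_bigcup.

Lemma measurable_rvec_eval (x : X) :
  measurable_fun [set: rvec R X] (fun f : rvec R X => f x).
Proof.
move=> _ B mB; apply: sub_sigma_algebra; exists x => //.
by exists B.
Qed.

Lemma measurable_fun_rvecP d (T : measurableType d) (f : T -> rvec R X) :
  (forall x, measurable_fun [set: T] (fun t => f t x)) ->
  measurable_fun [set: T] f.
Proof.
move=> mf; apply: (measurability (\bigcup_(x in [set: X])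
  preimage_set_system setT (fun f : rvec R X => f x) measurable)) => //.
move=> _ [_ [x _ [B mB <-]] <-]; rewrite setTI.
by have := mf x measurableT B mB; rewrite !setTI.
Qed.

End rvec_measurable.

Section power_probability.
Context d (T : measurableType d) (R : realType) (P : probability T R).

Let product_setT n (Q : probability (n.-tuple T) R) : (P \x Q)%E setT = 1%E.
Proof.
rewrite -setXTT [LHS]product_measure1E//.
by rewrite -[RHS]mule1; congr mule; exact: probability_setT.
Qed.

HB.instance Definition _ n (Q : probability (n.-tuple T) R) :=
  Measure_isProbability.Build _ _ _ (P \x Q)%E (product_setT Q).

Definition cons_pair n (x : T * n.-tuple T) : n.+1.-tuple T :=
  [tuple of x.1 :: x.2].

Lemma measurable_cons_pair n :
  measurable_fun [set: T * n.-tuple T] (@cons_pair n).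
Proof. exact: (measurable_cons measurable_fst measurable_snd). Qed.

HB.instance Definition _ n :=
  isMeasurableFun.Build _ _ _ _ (@cons_pair n) (@measurable_cons_pair n).

(* The law of n independent draws from P. *)
Fixpoint power_prob n : probability (n.-tuple T) R :=
  match n with
  | 0 => \d_([tuple] : 0.-tuple T)
  | n'.+1 => distribution (P \x power_prob n')%E (@cons_pair n')
  end.

Lemma power_probE n (A : 'I_n -> set T) : (forall i, measurable (A i)) ->
  power_prob n [set x | forall i, A i (tnth x i)] = (\prod_(i < n) P (A i))%E.
Proof.
elim: n A => [|n IH] A mA.
  rewrite big_ord0 /= diracE mem_set //=.
  by case.
rewrite big_ord_recl /= /distribution /pushforward /=.
rewrite -IH //.
rewrite -[RHS](@product_measure1E _ _ _ _ _ P (power_prob n)) //; last first.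
  have -> : [set x : n.-tuple T | forall i, A (lift ord0 i) (tnth x i)] =
      \bigcap_(i in [set: 'I_n]) ((fun x => tnth x i) @^-1` A (lift ord0 i)).
    by apply/seteqP; split => x /= h; [move=> i _|move=> i]; apply: h.
  apply: fin_bigcap_measurable => // i _; rewrite -[X in measurable X]setTI.
  exact: measurable_tnth.
congr (product_measure1 _ _ _).
apply/seteqP; split => -[x t] /= h.
  split => [|i]; first by have := h ord0; rewrite tnth0.
  by have := h (lift ord0 i); rewrite tnthS.
case: h => hx ht i; case: (unliftP ord0 i) => [j|] ->.
  by rewrite tnthS.
by rewrite tnth0.
Qed.

End power_probability.

Section markov_chain.
Context (R : realType) (X : finType).

Definition unit_prob : probability _ R := uniform_prob (@ltr01 R).

Fixpoint path_prob (k : X -> fdist R X) (x : X) (w : seq X) : R :=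
  if w is y :: w' then k x y * path_prob k y w' else 1.

(* Z is a Markov chain on the probability space [0, 1] with initial law d and
   transition kernel k. *)
Definition is_markov_chain (d : fdist R X) (k : X -> fdist R X)
    (Z : R -> nat -> X) : Prop :=
  (forall n x, measurable [set u : measurableTypeR R | Z u n = x]) /\
  (forall x w, unit_prob [set u | mkseq (Z u) (size w).+1 = x :: w] =
    (d x * path_prob k x w)%:E).

Section existence.
Variables (d : fdist R X) (k : X -> fdist R X).

Let next_law (o : option X) : fdist R X := if o is Some x then k x else d.

Let cum (f : fdist R X) (x : X) : R :=
  \sum_(y | (enum_rank y < enum_rank x)%N) f y.

(* (last letter, left end point, length) of the interval coding a word *)
Let step (s : option X * R * R) (x : X) : option X * R * R :=
  (Some x, s.1.2 + s.2 * cum (next_law s.1.1) x, s.2 * next_law s.1.1 x).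
Let st (w : seq X) := foldl step (None, 0, 1) w.

Let In (s : option X * R * R) (u : R) := s.1.2 <= u < s.1.2 + s.2.

Let cum_ge0 f x : 0 <= cum f x.
Proof. by apply: sumr_ge0 => y _; exact: fdist_ge0. Qed.

Let cumS f x : cum f x + f x = \sum_(y | (enum_rank y <= enum_rank x)%N) f y.
Proof.
rewrite [RHS](bigD1 x) //= addrC; congr (_ + _).
apply: eq_bigl => y; rewrite ltn_neqAle andbC; congr (_ && _).
by rewrite (inj_eq val_inj) (inj_eq enum_rank_inj).
Qed.

Let cum_le f x y : (enum_rank x < enum_rank y)%N -> cum f x + f x <= cum f y.
Proof.
move=> xy; rewrite cumS /cum [leRHS](bigID (fun z => enum_rank z <= enum_rank x)%N) /=.
rewrite [X in _ <= X + _](eq_bigl (fun z => enum_rank z <= enum_rank x)%N).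
  by rewrite lerDl; apply: sumr_ge0 => z _; exact: fdist_ge0.
move=> z; case: (leqP (enum_rank z) (enum_rank x)) => zx; rewrite ?andbF //.
by rewrite (leq_ltn_trans zx xy).
Qed.

Let cum_le1 f x : cum f x + f x <= 1.
Proof.
rewrite cumS -(fdist_sum1 f) [leRHS](bigID (fun z => enum_rank z <= enum_rank x)%N) /=.
by rewrite lerDl; apply: sumr_ge0 => z _; exact: fdist_ge0.
Qed.

Let exists_piece f t : 0 <= t < 1 -> exists x, cum f x <= t < cum f x + f x.
Proof.
move=> /andP[t0 t1]; apply: contrapT => /forallNP nx.
have H (m : nat) : (m <= #|X|)%N ->
    \sum_(y | (enum_rank y < m)%N) f y <= t.
  elim: m => [_|m IH mX]; first by rewrite big1.
  have := nx (enum_val (Ordinal mX)).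
  have -> : cum f (enum_val (Ordinal mX)) = \sum_(y | (enum_rank y < m)%N) f y.
    by apply: eq_bigl => y; rewrite enum_valK.
  move=> /negP; rewrite IH ?(ltnW mX) //= -leNgt; apply: le_trans.
  have := cumS f (enum_val (Ordinal mX)).
  rewrite (_ : cum f _ = \sum_(y | (enum_rank y < m)%N) f y); last first.
    by apply: eq_bigl => y; rewrite enum_valK.
  move=> ->; rewrite le_eqVlt; apply/orP; left; apply/eqP.
  by apply: eq_bigl => y; rewrite enum_valK ltnS.
have := H #|X| (leqnn _); rewrite leNgt => /negP; apply.
rewrite (eq_bigl xpredT); first by rewrite fdist_sum1.
by move=> y; rewrite ltn_ord.
Qed.

Let st_rcons w x : st (rcons w x) = step (st w) x.
Proof. by rewrite /st foldl_rcons. Qed.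

Let st2_ge0 w : 0 <= (st w).2.
Proof.
elim/last_ind: w => [|w x IH]; first exact: ler01.
by rewrite st_rcons /= mulr_ge0 ?fdist_ge0.
Qed.

Let In_step w x u : In (step (st w) x) u -> In (st w) u.
Proof.
rewrite /In /step /= => /andP[ux xu]; apply/andP; split.
  by apply: le_trans ux; rewrite lerDl mulr_ge0.
apply: (lt_le_trans xu); rewrite -addrA lerD2l -mulrDr.
by rewrite ler_piMr.
Qed.

Let In_piece w u : In (st w) u -> exists x, In (step (st w) x) u.
Proof.
rewrite /In; set s := st w => /andP[su us].
have s0 : 0 < s.2 by move: us su; lra.
have [|x /andP[xu ux]] := @exists_piece (next_law s.1.1) ((u - s.1.2) / s.2).
  by rewrite ltr_pdivrMr // mul1r divr_ge0 ?(ltW s0) ?subr_ge0 //=; lra.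
exists x; rewrite /step /=.
move: xu ux; rewrite ler_pdivlMr // ltr_pdivrMr // mulrDl ![_ * s.2]mulrC.
by move=> *; apply/andP; split; lra.
Qed.

Let piece_inj w u x y : In (step (st w) x) u -> In (step (st w) y) u -> x = y.
Proof.
suff H x' y' : (enum_rank x' < enum_rank y')%N ->
    In (step (st w) x') u -> In (step (st w) y') u -> False.
  move=> hx hy; case: (ltngtP (enum_rank x) (enum_rank y)) => [xy|yx|/val_inj].
  - by case: (H _ _ xy hx hy).
  - by case: (H _ _ yx hy hx).
  - exact: enum_rank_inj.
move=> /(cum_le (next_law (st w).1.1)) le /andP[_ ux] /andP[yu _].
have := le_lt_trans yu ux; rewrite /step /= -addrA ltrD2l -mulrDr.
by apply/negP; rewrite -leNgt ler_wpM2l.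
Qed.

Let x0 : X.
Proof.
case: (pickP (fun _ : X => true)) => [x _|nX]; first exact: x.
exfalso; have := fdist_sum1 d; rewrite big1 => [/esym/eqP|x _].
  by rewrite oner_eq0.
by have := nX x.
Qed.

Let next s (u : R) : X := odflt x0 [pick x | In (step s x) u].
Let state (u : R) n := iter n (fun s => step s (next s u)) (None, 0, 1).
Let clamp (u : R) : R := if 0 <= u < 1 then u else 0.
Let Z (u : R) n : X := next (state (clamp u) n) (clamp u).

Let stateE u n : state (clamp u) n = st (mkseq (Z u) n).
Proof.
elim: n => [//|n IH].
by rewrite /mkseq -addn1 iotaD map_cat /= cats1 st_rcons -IH addn1 /state iterS.
Qed.

Let clamp01 u : 0 <= clamp u < 1.
Proof. by rewrite /clamp; case: ifP => // _; rewrite lexx ltr01. Qed.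

Let mkseqSr u n : mkseq (Z u) n.+1 = rcons (mkseq (Z u) n) (Z u n).
Proof. by rewrite /mkseq -addn1 iotaD map_cat /= cats1. Qed.

Let In_Z u n : In (st (mkseq (Z u) n)) (clamp u).
Proof.
elim: n => [|n IH]; first by rewrite /In /= add0r clamp01.
rewrite mkseqSr st_rcons {2}/Z /next stateE.
case: pickP => [x //|nx].
by have [x] := In_piece IH; rewrite nx.
Qed.

Let Z_In u w : In (st w) (clamp u) -> mkseq (Z u) (size w) = w.
Proof.
elim/last_ind: w => [//|w x IH]; rewrite st_rcons => hx.
rewrite size_rcons mkseqSr (IH (In_step hx)); congr rcons.
have := In_Z u (size w).+1; rewrite mkseqSr st_rcons IH; last exact: In_step hx.
by move=> h; apply: piece_inj h hx.
Qed.

Let mkseq_ZE u w : (mkseq (Z u) (size w) = w) <-> In (st w) (clamp u).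
Proof. by split => [<-|/Z_In//]; exact: In_Z. Qed.

Let In01 w u : In (st w) u -> 0 <= u < 1.
Proof.
elim/last_ind: w => [|w x IH]; first by rewrite /In /= add0r.
by rewrite st_rcons => /In_step.
Qed.

Let st1_ge0 w : 0 <= (st w).1.2.
Proof.
elim/last_ind: w => [|w x IH]; first exact: lexx.
by rewrite st_rcons /= addr_ge0 // mulr_ge0.
Qed.

Let st_le1 w : (st w).1.2 + (st w).2 <= 1.
Proof.
elim/last_ind: w => [|w x IH]; first by rewrite /= add0r.
rewrite st_rcons /=; apply: le_trans IH; rewrite -addrA lerD2l -mulrDr.
by rewrite ler_piMr.
Qed.

Let ZsetE w : [set u : measurableTypeR R | mkseq (Z u) (size w) = w] =
  ([set` `[(st w).1.2, (st w).1.2 + (st w).2[] `|`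
    (if In (st w) 0 then ~` [set` `[0%R, 1%R[] else set0)).
Proof.
apply/seteqP; split => u.
  move=> /(mkseq_ZE u w).1; rewrite /clamp; case: ifP => u01 h.
    by left; rewrite /= in_itv.
  by right; rewrite h /= in_itv /= u01.
move=> [|]; last case: ifP => // h0; rewrite /= in_itv /= => h.
  by apply/(mkseq_ZE u w).2; rewrite /clamp (In01 h).
by apply/(mkseq_ZE u w).2; rewrite /clamp ifN //; apply/negP.
Qed.

Let measurable_Zset w :
  measurable [set u : measurableTypeR R | mkseq (Z u) (size w) = w].
Proof.
rewrite ZsetE; apply: measurableU; first exact: measurable_itv.
by case: ifP => // _; apply: measurableC; exact: measurable_itv.
Qed.

Let unit_prob_itv (a b : R) : 0 <= a -> a <= b -> b <= 1 ->
  unit_prob [set` `[a, b[] = (b - a)%:E.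
Proof.
move=> a0 ab b1.
transitivity (\int[lebesgue_measure]_(x in `[a, b[) (uniform_pdf 0 1 x)%:E)%E.
  by [].
rewrite (eq_integral (fun=> 1%:E)); last first.
  move=> u; rewrite inE /= in_itv /= => /andP[au ub].
  by rewrite /uniform_pdf subr0 invr1 (le_trans a0 au) (le_trans (ltW ub) b1).
rewrite integral_cst //= mul1e lebesgue_measure_itv /= lte_fin.
case: ltP => // ba; have -> : b = a by apply/eqP; rewrite eq_le ba ab.
by rewrite subrr.
Qed.

Let unit_prob_out : unit_prob (~` [set` `[0%R, 1%R[]) = 0%E.
Proof.
rewrite probability_setC ?unit_prob_itv ?subr0 ?subee //; exact: measurable_itv.
Qed.

Let unit_prob_Z w :
  unit_prob [set u | mkseq (Z u) (size w) = w] = (st w).2%:E.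
Proof.
have mI : measurable [set` `[(st w).1.2, (st w).1.2 + (st w).2[].
  exact: (@measurable_itv R).
have <- : unit_prob [set` `[(st w).1.2, (st w).1.2 + (st w).2[] = (st w).2%:E.
  rewrite unit_prob_itv ?lerDl; [|exact: st1_ge0|exact: st2_ge0|exact: st_le1].
  by congr EFin; ring.
rewrite ZsetE; case: ifP => _; last by rewrite setU0.
rewrite measureU0 //; apply: measurableC; exact: measurable_itv.
Qed.

Let st2E x w : (st (x :: w)).2 = d x * path_prob k x w.
Proof.
have gen v y l m : (foldl step (Some y, l, m) v).2 = m * path_prob k y v.
  elim: v y l m => [|z v IH] y l m /=; first by rewrite mulr1.
  by rewrite IH mulrA.
by rewrite /st /= gen mul1r.
Qed.

Lemma markov_chain_exists : exists Z, is_markov_chain d k Z.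
Proof.
exists Z; split=> [n x|x w]; last by rewrite (unit_prob_Z (x :: w)) st2E.
have -> : [set u : measurableTypeR R | Z u n = x] =
    \bigcup_(w in [set: n.-tuple X])
      [set u : measurableTypeR R | mkseq (Z u) (size (rcons w x)) = rcons w x].
  apply/seteqP; split => u /=.
    move=> <-; have sz : size (mkseq (Z u) n) == n by rewrite size_mkseq.
    by exists (Tuple sz) => //=; rewrite size_rcons size_mkseq mkseqSr.
  move=> [w _ /=]; rewrite size_rcons size_tuple mkseqSr => /eqP.
  by rewrite eqseq_rcons => /andP[_ /eqP].
by apply: fin_bigcup_measurable => // w _; exact: measurable_Zset.
Qed.

End existence.
End markov_chain.

Definition markov_chain (R : realType) (X : finType) (d : fdist R X)
    (k : X -> fdist R X) : R -> nat -> X :=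
  sval (cid (markov_chain_exists d k)).

Lemma markov_chainP (R : realType) (X : finType) (d : fdist R X)
  (k : X -> fdist R X) : is_markov_chain d k (markov_chain d k).
Proof. exact: (svalP (cid (markov_chain_exists d k))). Qed.

Record mdp (R : realType) (S A : finType) := MDP {
  transition : S -> A -> fdist R S ;
  initial : fdist R S ;
  discount : R ;
  discount_ge0 : 0 <= discount ;
  discount_lt1 : discount < 1 }.

Definition policy (R : realType) (S A : finType) : Type := S -> fdist R A.

Notation reward R S A := (rvec R (S * A * S)%type).

Definition reward_bounded (R : realType) (S A : finType) (U : R)
    (r : reward R S A) : Prop :=
  forall x, `|r x| <= U.

Section returns.
Context (R : realType) (S A : finType) (M : mdp R S A).
Implicit Types (pi : policy R S A) (r : reward R S A).

(* The i-th letter of a trajectory is the pair (S_i, A_(i+1)). *)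
Definition trajectory_kernel pi (x : S * A) : fdist R (S * A)%type :=
  fdist_pair (transition M x.1 x.2) pi.

Definition discounted_sum r (z : nat -> S * A) : R :=
  limn (series (fun i => discount M ^+ i * r (z i, (z i.+1).1))).

(* (1 - gamma) E[sum_i gamma^i r(S_i, A_(i+1), S_(i+1))] with (S_0, A_1) ~ d and
   the later actions drawn from pi. *)
Definition expected_return (d : fdist R (S * A)%type) pi r : R :=
  (1 - discount M) *
  fine ('E_(@unit_prob R)
    [fun u => discounted_sum r (markov_chain d (trajectory_kernel pi) u)])%E.

Definition value0 pi r : R :=
  expected_return (fdist_pair (initial M) pi) pi r.

Definition qvalue (s : S) (a : A) pi r : R :=
  expected_return (fdist1 (s, a)) pi r.

Definition value (s : S) pi r : R := \sum_a pi s a * qvalue s a pi r.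

Definition advantage (s : S) (a : A) pi r : R :=
  qvalue s a pi r - value s pi r.

End returns.

Section cfr.
Context (R : realType) (S A : finType) (M : mdp R S A).

(* One deterministic learner per state: from the utility vectors observed so far,
   oldest first, to the next distribution on actions. *)
Definition learners : Type := S -> seq (rvec R A) -> fdist R A.

Definition measurable_learners (L : learners) : Prop :=
  forall s t a, measurable_fun [set: t.-tuple (rvec R A)]
    (fun h : t.-tuple (rvec R A) => L s h a).

Variable L : learners.

Definition cfr_update (h : S -> seq (rvec R A)) (r : reward R S A) :
    S -> seq (rvec R A) :=
  let pi : policy R S A := fun s => L s (h s) in
  fun s => rcons (h s) (fun a => qvalue M s a pi r).

Definition cfr_history (rs : seq (reward R S A)) : S -> seq (rvec R A) :=
  foldl cfr_update (fun=> [::]) rs.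

(* The policy played once the rewards rs, oldest first, have been revealed. *)
Definition cfr_policy (rs : seq (reward R S A)) : policy R S A :=
  fun s => L s (cfr_history rs s).

(* The learners being deterministic, an adaptively chosen sequence of rewards is
   no more general than an arbitrary one. *)
Definition cfr_regret_bound (U : R) (C : nat -> R) : Prop :=
  forall r : nat -> reward R S A, (forall t, reward_bounded U (r t)) ->
  forall T : nat, (1 <= T)%N -> forall s a,
    \sum_(t < T) advantage M s a (cfr_policy (mkseq r t)) (r t) <= C T.

End cfr.

Section kofn.
Context (R : realType) (S A : finType) (M : mdp R S A) (k N : nat).

(* rule vs rs i is the index of the i-th smallest key; ties may be broken in any
   measurable way depending on the keys vs and on the items rs. *)
Definition sorting_rule (rule : N.-tuple R -> N.-tuple (reward R S A) -> 'S_N) :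
    Prop :=
  (forall vs rs (i j : 'I_N), (i <= j)%N ->
     tnth vs (rule vs rs i) <= tnth vs (rule vs rs j)) /\
  (forall sigma : 'S_N, measurable
     [set x : N.-tuple R * N.-tuple (reward R S A) | rule x.1 x.2 = sigma]).

Variable rule : N.-tuple R -> N.-tuple (reward R S A) -> 'S_N.

Definition kofn_reward (pi : policy R S A) (rs : N.-tuple (reward R S A)) :
    reward R S A :=
  let sigma := rule [tuple of map (value0 M pi) rs] rs in
  fun x => k%:R^-1 * \sum_(j < N | (j < k)%N) tnth rs (sigma j) x.

Definition kofn_dist (rho : probability (reward R S A) R) (pi : policy R S A) :
    set (reward R S A) -> \bar R :=
  pushforward (power_prob rho N) (kofn_reward pi).

Definition kofn_value (rho : probability (reward R S A) R) (pi : policy R S A) :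
    R :=
  fine (\int[kofn_dist rho pi]_r (value0 M pi r)%:E)%E.

Variable L : learners R S A.

(* Rewards fed to the learners during the first t iterations, where x i is the
   sample drawn at iteration i (iterations are numbered from 0). *)
Fixpoint kofn_cfr_rewards (x : nat -> N.-tuple (reward R S A)) (t : nat) :
    seq (reward R S A) :=
  if t is t'.+1 then
    let rs := kofn_cfr_rewards x t' in
    rcons rs (kofn_reward (cfr_policy M L rs) (x t'))
  else [::].

Definition kofn_cfr_policy (x : nat -> N.-tuple (reward R S A)) (t : nat) :
    policy R S A :=
  cfr_policy M L (kofn_cfr_rewards x t).

Definition full_regret (rho : probability (reward R S A) R)
    (x : nat -> N.-tuple (reward R S A)) (T : nat) (pi : policy R S A) : R :=
  \sum_(t < T) (kofn_value rho pi - kofn_value rho (kofn_cfr_policy x t)).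

End kofn.

Section iid.
Context d d' (Omega : measurableType d) (T : measurableType d') (R : realType)
  (P : probability Omega R) (I : eqType).

Definition mutually_independent (X : I -> {RV P >-> T}) : Prop :=
  forall (J : seq I) (D : I -> set T), uniq J -> (forall i, measurable (D i)) ->
    P [set w | forall i, i \in J -> D i (X i w)] =
    (\prod_(i <- J) P (X i @^-1` D i))%E.

Definition iid (rho : probability T R) (X : I -> {RV P >-> T}) : Prop :=
  (forall i D, measurable D -> distribution P (X i) D = rho D) /\
  mutually_independent X.

End iid.

(* Main.v *)
From HB Require Import structures.
Require Import Defs.
From mathcomp Require Import all_boot all_order all_algebra perm.
From mathcomp Require Import all_classical all_reals all_analysis.
From mathcomp Require Import measurable_realfun ring lra.

Set Implicit Arguments.
Unset Strict Implicit.
Unset Printing Implicit Defensive.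

Import Order.TTheory GRing.Theory Num.Theory.
Import numFieldNormedType.Exports.

Local Open Scope classical_set_scope.
Local Open Scope ring_scope.

(* Let W pi be the k-of-N value of pi, m(pi, pi') the mean value of pi against the
   rewards selected for pi', and rbar_t the reward fed to the learners at round t.
   Since the k worst rewards for pi minimise the value of pi, W pi <= m(pi, pi_t).
   Hence the regret at round t is at most m(pi, pi_t) - m(pi_t, pi_t), which is the
   sampled difference v(pi; rbar_t) - v(pi_t; rbar_t) plus a centered noise.
   The sampled differences sum to at most C T / (1 - discount) by the Bellman
   equations, and the noise is a martingale difference bounded by 4 U, so that the
   Azuma-Hoeffding argument bounds its sum: the joint law of the samples is a
   product, and the exponential moment factors round by round. *)

(** An expected return is an integral over [0, 1] along a chain known only through the law of its
    finite words. It is therefore identified with a limit of [truncated_return], an explicit finite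
    expression; recursion, linearity and measurability are proved there and pass to the limit.

    No conditional expectation appears. What the learners have seen is a state updated by one
    sample, and the exponential moment is bounded for every starting state, so that integrating out
    the first sample last replaces conditioning on the past. The CFR bound is deterministic and is
    used path by path; it asks for bounded rewards, which [rho] grants only almost surely, so a null
    set is discarded.

    The constant 4 U comes from bounding four values in [- U, U] separately. A centered variable
    bounded by b has exponential moment at most exp((l b)^2 / 2); over T rounds, with b = 4 U and
    the best l, the noise exceeds 4 U a with probability at most exp(- a^2 / (2 T)), which is p for
    a = sqrt(2 T log(1/p)). The best l divides by U, so U = 0 is treated apart. *)

Section kernel_mean.
Context {R : realType}.

Definition fmean (X : finType) (d : fdist R X) (f : X -> R) : R :=
  \sum_x d x * f x.

Lemma ler_fmean (X : finType) (d : fdist R X) (f g : X -> R) :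
  (forall x, f x <= g x) -> fmean d f <= fmean d g.
Proof. by move=> fg; apply: ler_sum => x _; rewrite ler_wpM2l ?fdist_ge0. Qed.

Lemma fmean_cst (X : finType) (d : fdist R X) c : fmean d (fun=> c) = c.
Proof. by rewrite /fmean -big_distrl /= fdist_sum1 mul1r. Qed.

(** The form [a * f x + g x] covers sums, multiples and, with [a = -1], differences at once. *)
Lemma fmean_lin (X : finType) (d : fdist R X) a (f g : X -> R) :
  fmean d (fun x => a * f x + g x) = a * fmean d f + fmean d g.
Proof.
by rewrite /fmean big_distrr -big_split; apply: eq_bigr => x _ /=; ring.
Qed.

Lemma eq_fmean (X : finType) (d : fdist R X) (f g : X -> R) :
  f =1 g -> fmean d f = fmean d g.
Proof. by move=> fg; apply: eq_bigr => x _; rewrite fg. Qed.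

Lemma fmean_fdist1 (X : finType) (x : X) (f : X -> R) :
  fmean (fdist1 x) f = f x.
Proof.
rewrite /fmean (bigD1 x) //= eqxx mul1r big1 ?addr0 // => y /negbTE ->.
by rewrite mul0r.
Qed.

Lemma fmean_fdist_pair (X Y : finType) (d : fdist R X) (k : X -> fdist R Y)
    (f : X * Y -> R) :
  fmean (fdist_pair d k) f = fmean d (fun x => fmean (k x) (fun y => f (x, y))).
Proof.
transitivity (\sum_x \sum_y d x * k x y * f (x, y)).
  by rewrite pair_bigA; apply: eq_bigr => -[x y].
apply: eq_bigr => x _; rewrite big_distrr /=; apply: eq_bigr => y _.
by rewrite mulrA.
Qed.

Lemma fdist_inhab (X : finType) (d : fdist R X) : X.
Proof.
case: (pickP (fun _ : X => true)) => [x _|nX]; first exact: x.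
exfalso; have := fdist_sum1 d; rewrite big1 => [/esym/eqP|x _].
  by rewrite oner_eq0.
by have := nX x.
Qed.

Lemma cvg_fmean (X : finType) (d : fdist R X) (f : nat -> X -> R) g :
  (forall x, f n x @[n --> \oo] --> g x) ->
  fmean d (f n) @[n --> \oo] --> fmean d g.
Proof.
move=> fg; apply: cvg_big => //; first exact: add_continuous.
by move=> x _; apply: cvgMl_tmp.
Qed.

(* Evaluating [f <= a + g m] at a maximum of [f] gives [max f <= a + g max f]. *)
Lemma discounted_le (X : finType) (g a : R) (f : X -> R) : g < 1 ->
  (forall m, (forall x, f x <= m) -> forall x, f x <= a + g * m) ->
  forall x, f x <= a / (1 - g).
Proof.
move=> g1 fH x0; have [x _ fx] := @arg_maxP _ R X x0 xpredT f isT.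
have g1' : 0 < 1 - g by rewrite subr_gt0.
apply: le_trans (fx x0 isT) _; rewrite ler_pdivlMr //.
have := fH _ (fun y => fx y isT) x; lra.
Qed.

End kernel_mean.

Lemma sum_tuple_cons (R : nmodType) (X : finType) n (f : n.+1.-tuple X -> R) :
  \sum_w f w = \sum_x \sum_(w : n.-tuple X) f [tuple of x :: w].
Proof.
rewrite pair_bigA.
rewrite (reindex (fun z : X * n.-tuple X => [tuple of z.1 :: z.2])) //=.
exists (fun w : n.+1.-tuple X => (thead w, [tuple of behead w])) => [[y w] _|w _].
  by congr pair; apply: val_inj.
by rewrite /= [RHS]tuple_eta; apply: val_inj.
Qed.

(** * Integrals of functions of finitely many steps of the Markov chain *)

Section chain_mean.
Context {R : realType} {X : finType} (d : fdist R X) (k : X -> fdist R X).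
Let Z := markov_chain d k.

(** The transition operator of the chain: its i-th iterate, at [x], is the mean of [f] after i steps
    from [x]. *)
Definition kernel_op (f : X -> R) : X -> R := fun x => fmean (k x) f.

(** Nested form of the sum of [F] against [path_prob]. A leading letter that [F] ignores becomes one
    application of [kernel_op], which the flat sum would hide. *)
Fixpoint word_mean n (F : seq X -> R) (x : X) : R :=
  if n is n'.+1 then fmean (k x) (word_mean n' (fun w => F (x :: w)))
  else F [:: x].

Lemma word_meanE n (F : seq X -> R) x :
  \sum_(w : n.-tuple X) path_prob k x w * F (x :: w) = word_mean n F x.
Proof.
elim: n F x => [|n IH] F x.
  rewrite (bigD1 [tuple]) //= mul1r big1 ?addr0 // => w.
  by move=> /eqP; case; exact: tuple0.
rewrite /= /fmean sum_tuple_cons /=.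
apply: eq_bigr => y _; rewrite -IH big_distrr /=; apply: eq_bigr => w _.
by rewrite mulrA.
Qed.

Lemma mkseqSr n u : mkseq (Z u) n.+1 = rcons (mkseq (Z u) n) (Z u n).
Proof. by rewrite /mkseq -addn1 iotaD map_cat /= cats1. Qed.

Lemma measurable_prefix n w :
  measurable [set u : measurableTypeR R | mkseq (Z u) n = w].
Proof.
elim: n w => [|n IH] w.
  have [->|w0] := eqVneq w [::].
    by rewrite (_ : [set _ | _] = setT) //; apply/seteqP; split.
  rewrite (_ : [set _ | _] = set0) //; apply/seteqP; split => // u /= w0'.
  by rewrite -w0' eqxx in w0.
case/lastP: w => [|w x].
  rewrite (_ : [set _ | _] = set0) //; apply/seteqP; split => // u /=.
rewrite (_ : [set _ | _] = [set u : measurableTypeR R | mkseq (Z u) n = w] `&`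
   [set u : measurableTypeR R | Z u n = x]).
  by apply: measurableI; [exact: IH | exact: (markov_chainP d k).1].
apply/seteqP; split => u /=; rewrite mkseqSr.
  by move=> /eqP; rewrite eqseq_rcons => /andP[/eqP -> /eqP ->].
by case=> -> ->.
Qed.

(** A prefix takes finitely many values, so a function of it is simple; its measurability and
    integral reduce to the sets of paths with a given prefix, whose probabilities are the word
    laws. *)
Lemma prefix_sumE n (F : seq X -> R) u :
  F (mkseq (Z u) n) = \sum_(w : n.-tuple X)
     F w * \1_[set u : measurableTypeR R | mkseq (Z u) n = w] u.
Proof.
have sz : size (mkseq (Z u) n) == n by rewrite size_mkseq.
rewrite (bigD1 (Tuple sz)) //= indicE mem_set // mulr1.
rewrite big1 ?addr0 // => w wn; rewrite indicE memNset ?mulr0 //= => wE.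
by move/negP: wn; apply; apply/eqP/val_inj; rewrite /= wE.
Qed.

Lemma measurable_prefix_fun n (F : seq X -> R) :
  measurable_fun setT (fun u : measurableTypeR R => F (mkseq (Z u) n)).
Proof.
rewrite (_ : (fun u => _) = fun u => \sum_(w : n.-tuple X)
     F w * \1_[set u : measurableTypeR R | mkseq (Z u) n = w] u); last first.
  by apply/funext => u; exact: prefix_sumE.
apply: measurable_sum => w; apply: measurable_funM => //.
apply: measurable_indic; exact: measurable_prefix.
Qed.

Lemma integral_prefix n (F : seq X -> R) :
  (\int[@unit_prob R]_u (F (mkseq (Z u) n.+1))%:E =
   (fmean d (word_mean n F))%:E)%E.
Proof.
pose B (w : n.+1.-tuple X) : set (measurableTypeR R) :=
  [set u : measurableTypeR R | mkseq (Z u) n.+1 = w].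
under eq_integral do rewrite prefix_sumE -sumEFin.
rewrite integral_sum //; last first.
  move=> w; rewrite (_ : (fun u => _) =
      (fun u => (F w)%:E * (\1_(B w) u)%:E)%E); last first.
    by apply/funext => u; rewrite EFinM.
  apply: integrableZl => //; apply: integrable_indic => //.
  exact: measurable_prefix.
transitivity (\sum_(w : n.+1.-tuple X)
    (F w * (d (thead w) * path_prob k (thead w) (behead w)))%:E)%E.
  apply: eq_bigr => w _.
  under eq_integral do rewrite EFinM.
  rewrite integralZl //; last first.
    apply: integrable_indic => //; exact: measurable_prefix.
  rewrite integral_indic ?setIT //; last exact: measurable_prefix.
  rewrite EFinM; congr (_ * _)%E.
  rewrite -(markov_chainP d k).2.
  suff -> : [set u | mkseq (markov_chain d k u) (size (behead w)).+1 =
      thead w :: behead w] = B w by [].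
  have wE : thead w :: behead w = w by rewrite {3}(tuple_eta w).
  by rewrite wE size_behead size_tuple.
rewrite sumEFin; congr EFin.
rewrite sum_tuple_cons.
apply: eq_bigr => y _; rewrite -word_meanE big_distrr /=; apply: eq_bigr => w _.
by ring.
Qed.

Lemma word_mean_last2 x0 (h : X -> X -> R) i :
  word_mean i.+1 (fun w => h (nth x0 w i) (nth x0 w i.+1)) =1
  iter i kernel_op (fun x => fmean (k x) (h x)).
Proof.
by elim: i => [|i IH] x //; rewrite iterS /kernel_op; apply: eq_fmean => y; exact: IH.
Qed.

Lemma integral_step (h : X -> X -> R) i :
  (\int[@unit_prob R]_u (h (Z u i) (Z u i.+1))%:E =
   (fmean d (iter i kernel_op (fun x => fmean (k x) (h x))))%:E)%E.
Proof.
have x0 : X := fdist_inhab d.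
rewrite -(eq_fmean d (word_mean_last2 x0 h i)) -integral_prefix.
by apply: eq_integral => u _; rewrite !nth_mkseq.
Qed.

Lemma measurable_step (h : X -> X -> R) i :
  measurable_fun setT (fun u : measurableTypeR R => h (Z u i) (Z u i.+1)).
Proof.
have x0 : X := fdist_inhab d.
have := @measurable_prefix_fun i.+2 (fun w => h (nth x0 w i) (nth x0 w i.+1)).
by apply: eq_measurable_fun => u _; rewrite !nth_mkseq.
Qed.

End chain_mean.

(** * Expected returns as limits of finite expressions *)

Section returns_theory.
Context {R : realType} {S A : finType} (M : mdp R S A).
Implicit Types (pi : policy R S A) (r : reward R S A) (x : S * A).
Let g := discount M.
Let K pi := trajectory_kernel M pi.

Definition mean_reward pi r x : R := fmean (K pi x) (fun y => r (x, y.1)).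

(** A chain-free stand-in for the return: linear in the reward, polynomial in the policy and subject
    to a one-step recursion, it transmits these features to its limit. *)
Definition truncated_return pi r n x : R :=
  (1 - g) * \sum_(i < n) g ^+ i * iter i (kernel_op (K pi)) (mean_reward pi r) x.

Let Z d pi := markov_chain d (K pi).

Let partial d pi r n (u : measurableTypeR R) : R :=
  \sum_(i < n) g ^+ i * r (Z d pi u i, (Z d pi u i.+1).1).

Let measurable_partial d pi r n : measurable_fun setT (partial d pi r n).
Proof.
apply: measurable_sum => i; apply: measurable_funM => //.
exact: (measurable_step d (K pi) (fun x y => r (x, y.1))).
Qed.

Let bnd r : R := \sum_y `|r y|.

Let le_bnd r y : `|r y| <= bnd r.
Proof. by rewrite /bnd (bigD1 y) //= lerDl sumr_ge0. Qed.

Let bnd_ge0 r : 0 <= bnd r. Proof. exact: sumr_ge0. Qed.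

Let g01 : `|g| < 1.
Proof. by rewrite ger0_norm ?discount_ge0 // discount_lt1. Qed.

Let g1 : 0 < 1 - g.
Proof. by rewrite subr_gt0 discount_lt1. Qed.

Let partial_bound d pi r n u : `|partial d pi r n u| <= bnd r / (1 - g).
Proof.
apply: le_trans (ler_norm_sum _ _ _) _.
apply: (@le_trans _ _ (\sum_(i < n) g ^+ i * bnd r)).
  apply: ler_sum => i _; rewrite normrM ger0_norm ?exprn_ge0 ?discount_ge0 //.
  by rewrite ler_wpM2l ?exprn_ge0 ?discount_ge0.
rewrite -big_distrl /= mulrC ler_wpM2l // -(@ler_pM2r _ (1 - g)) // mulVf ?gt_eqF //.
have := @subrX1 _ g n; rewrite -/g => E.
have -> : (\sum_(i < n) g ^+ i) * (1 - g) = 1 - g ^+ n by move: E; lra.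
by rewrite gerBl exprn_ge0 // discount_ge0.
Qed.

Let cvg_partial d pi r u :
  partial d pi r n u @[n --> \oo] -->
    discounted_sum M r (markov_chain d (K pi) u).
Proof.
rewrite (_ : (fun n => partial d pi r n u) = series (fun i =>
   g ^+ i * r (Z d pi u i, (Z d pi u i.+1).1))); last first.
  by apply/funext => n; rewrite /partial /series /= big_mkord.
(* [discounted_sum] is the [limn] of this series, hence its limit as soon as the series converges;
   it does so absolutely, by comparison with a geometric series. *)
suff : cvgn (series (fun i => g ^+ i * r (Z d pi u i, (Z d pi u i.+1).1))) by [].
apply: normed_cvg; apply: (@series_le_cvg _ _ (geometric (bnd r) g)) => //.
- by move=> n /=; exact: normr_ge0.
- by move=> n; rewrite /geometric /= mulr_ge0 ?exprn_ge0 ?discount_ge0.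
- move=> n; rewrite /geometric /= normrM ger0_norm ?exprn_ge0 ?discount_ge0 //.
  by rewrite mulrC ler_wpM2r ?exprn_ge0 ?discount_ge0.
- exact: is_cvg_geometric_series.
Qed.

(** Dominated convergence for the partial sums, all bounded by [bnd r / (1 - g)]; each is integrated
    term by term with [integral_step]. *)
Lemma cvg_expected_return d pi r :
  fmean d (truncated_return pi r n) @[n --> \oo] --> expected_return M d pi r.
Proof.
have trE n : fmean d (truncated_return pi r n) =
    (1 - g) * fine (\int[@unit_prob R]_u (partial d pi r n u)%:E)%E.
  under eq_integral do rewrite -sumEFin.
  rewrite integral_sum //; last first.
    move=> i; apply: measurable_bounded_integrable => //.
    - by rewrite (le_lt_trans (probability_le1 _ _)) // ltry.
    - apply: measurable_funM => //.
      exact: (measurable_step d (K pi) (fun x y => r (x, y.1))).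
    - exists (bnd r); split; first exact: num_real.
      move=> y yr u _ /=; rewrite normrM ger0_norm ?exprn_ge0 ?discount_ge0 //.
      apply: le_trans (ltW yr); rewrite -[leRHS]mul1r.
      apply: ler_pM => //; first by rewrite exprn_ge0 // discount_ge0.
      by rewrite exprn_ile1 ?discount_ge0 // ltW ?discount_lt1.
  rewrite (eq_bigr (fun i : 'I_n => (g ^+ i *
     fmean d (iter i (kernel_op (K pi)) (mean_reward pi r)))%:E)); last first.
    move=> i _; under eq_integral do rewrite EFinM.
    rewrite integralZl //; last first.
      apply: measurable_bounded_integrable => //.
      - by rewrite (le_lt_trans (probability_le1 _ _)) // ltry.
      - exact: (measurable_step d (K pi) (fun x y => r (x, y.1))).
      - exists (bnd r); split; first exact: num_real.
        by move=> y yr u _ /=; apply: le_trans (ltW yr); apply: le_trans (le_bnd r _).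
    by rewrite (integral_step d (K pi) (fun x y => r (x, y.1)) i) EFinM.
  rewrite sumEFin /= /truncated_return /fmean.
  rewrite (eq_bigr (fun x => (1 - g) * \sum_(i < n) d x *
      (g ^+ i * iter i (kernel_op (K pi)) (mean_reward pi r) x))); last first.
    by move=> x _; rewrite mulrCA big_distrr.
  rewrite -big_distrr exchange_big /=; congr (_ * _).
  apply: eq_bigr => i _; rewrite big_distrr /=; apply: eq_bigr => x _; ring.
under eq_fun do rewrite trE.
rewrite /expected_return; apply: cvgMl_tmp; apply: fine_cvg.
rewrite unlock.
have intf : (@unit_prob R).-integrable setT (cst (bnd r / (1 - g))%:E).
  by apply: finite_measure_integrable_cst.
have [] := @dominated_convergence _ _ _ (@unit_prob R) setT measurableT
  (fun n u => (partial d pi r n u)%:E)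
  (fun u => (discounted_sum M r (markov_chain d (K pi) u))%:E)
  (cst (bnd r / (1 - g))%:E).
- by move=> n; apply/measurable_EFinP.
- apply/measurable_EFinP.
  apply: (@measurable_fun_cvg _ _ _ _ (partial d pi r)) => [m|u _].
    exact: measurable_partial.
  exact: cvg_partial.
- by apply: aeW => u _; apply: cvg_EFin; [exact: nearW | exact: cvg_partial].
- exact: intf.
- by apply: aeW => u n _ /=; rewrite lee_fin.
move=> /integrable_fin_num -/(_ measurableT) fin _.
by rewrite fineK.
Qed.

End returns_theory.

Lemma cvgn_unique {R : realType} (u : nat -> R) (l l' : R) :
  u n @[n --> \oo] --> l -> u n @[n --> \oo] --> l' -> l = l'.
Proof. by move=> /cvg_lim <- // /cvg_lim <-. Qed.

(** * Bellman equations, linearity, bounds and regret decomposition *)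

Section value_theory.
Context {R : realType} {S A : finType} (M : mdp R S A).
Implicit Types (pi : policy R S A) (r : reward R S A) (x : S * A).
Let g := discount M.
Let g0 : 0 <= g. Proof. exact: discount_ge0. Qed.
Let g1 : g < 1. Proof. exact: discount_lt1. Qed.

Lemma cvg_qvalue pi r s a :
  truncated_return M pi r n (s, a) @[n --> \oo] --> qvalue M s a pi r.
Proof.
have := @cvg_expected_return _ _ _ M (fdist1 (s, a)) pi r.
by under eq_fun do rewrite fmean_fdist1.
Qed.

(** Both sides are limits of the same means of truncated returns. Uniqueness of limits yields the
    Bellman equation and linearity below in the same way. *)
Lemma expected_returnE (d : fdist R (S * A)%type) pi r :
  expected_return M d pi r = fmean d (fun x => qvalue M x.1 x.2 pi r).
Proof.
apply: (@cvgn_unique _ (fun n => fmean d (truncated_return M pi r n))).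
  exact: cvg_expected_return.
by apply: cvg_fmean => -[s a]; exact: cvg_qvalue.
Qed.

Lemma value0E pi r :
  value0 M pi r = fmean (initial M) (fun s => value M s pi r).
Proof. by rewrite /value0 expected_returnE fmean_fdist_pair. Qed.

Lemma mean_rewardE pi r s a :
  mean_reward M pi r (s, a) = fmean (transition M s a) (fun s' => r (s, a, s')).
Proof.
rewrite /mean_reward /trajectory_kernel fmean_fdist_pair /=.
by apply: eq_fmean => s'; rewrite fmean_cst.
Qed.

Lemma kernel_opE pi (f : S * A -> R) s a :
  kernel_op (trajectory_kernel M pi) f (s, a) =
  fmean (transition M s a) (fun s' => fmean (pi s') (fun a' => f (s', a'))).
Proof. by rewrite /kernel_op /trajectory_kernel fmean_fdist_pair. Qed.

Lemma truncated_returnS pi r n x :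
  truncated_return M pi r n.+1 x = (1 - g) * mean_reward M pi r x +
    g * kernel_op (trajectory_kernel M pi) (truncated_return M pi r n) x.
Proof.
rewrite /truncated_return -/g big_ord_recl expr0 mul1r mulrDr; congr (_ + _).
rewrite [kernel_op _ _ x]/kernel_op /fmean.
rewrite (eq_bigr (fun y => (1 - g) * \sum_(i < n) trajectory_kernel M pi x y *
  (g ^+ i * iter i (kernel_op (trajectory_kernel M pi)) (mean_reward M pi r) y))); last first.
  by move=> y _; rewrite mulrCA big_distrr.
rewrite -big_distrr exchange_big [RHS]mulrCA; congr (_ * _).
rewrite big_distrr; apply: eq_bigr => i _; rewrite lift0 exprS iterS -mulrA.
congr (_ * _); rewrite [kernel_op _ _ x]/kernel_op /fmean big_distrr.
by apply: eq_bigr => y _; rewrite mulrCA.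
Qed.

Lemma qvalue_bellman pi r s a :
  qvalue M s a pi r = (1 - g) * mean_reward M pi r (s, a) +
    g * fmean (transition M s a) (fun s' => value M s' pi r).
Proof.
apply: (@cvgn_unique _ (fun n => truncated_return M pi r n.+1 (s, a))).
  rewrite (cvg_shiftS (fun n => truncated_return M pi r n (s, a))).
  exact: cvg_qvalue.
under eq_cvg do rewrite truncated_returnS.
apply: cvgD; first exact: cvg_cst.
apply: cvgMl_tmp.
under eq_cvg do rewrite kernel_opE.
by apply: cvg_fmean => s'; apply: cvg_fmean => a'; exact: cvg_qvalue.
Qed.

Lemma qvalue_le pi r U : (forall y, r y <= U) -> forall s a, qvalue M s a pi r <= U.
Proof.
(* The form [a / (1 - g)] of [discounted_le], with [a = (1 - g) * U]: the normalization of returns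
   by [1 - g] keeps the bound at [U]. *)
move=> rU s a; have -> : U = (1 - g) * U / (1 - g).
  by rewrite mulrC mulKf // subr_eq0 gt_eqF.
apply: (@discounted_le _ _ g _ (fun x : S * A => qvalue M x.1 x.2 pi r) g1 _ (s, a)).
move=> m qm [s' a'] /=; rewrite qvalue_bellman lerD //.
  rewrite ler_wpM2l ?subr_ge0 ?(ltW g1) // mean_rewardE.
  by rewrite -[leRHS](fmean_cst (transition M s' a')) ler_fmean.
rewrite ler_wpM2l // -[leRHS](fmean_cst (transition M s' a')) ler_fmean // => s''.
rewrite -[leRHS](fmean_cst (pi s'')) ler_fmean // => a''.
exact: (qm (s'', a'')).
Qed.

Lemma kernel_op_lin (k : S * A -> fdist R (S * A)%type) c f f' n :
  iter n (kernel_op k) (fun x => c * f x + f' x) =1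
  (fun x => c * iter n (kernel_op k) f x + iter n (kernel_op k) f' x).
Proof.
elim: n => [//|n IH] x; rewrite !iterS {1}/kernel_op (eq_fmean _ IH).
exact: fmean_lin.
Qed.

Lemma qvalue_lin pi c r r' s a :
  qvalue M s a pi (fun y => c * r y + r' y) =
  c * qvalue M s a pi r + qvalue M s a pi r'.
Proof.
apply: (@cvgn_unique _
  (fun n => truncated_return M pi (fun y => c * r y + r' y) n (s, a))).
  exact: cvg_qvalue.
have trE n : truncated_return M pi (fun y => c * r y + r' y) n (s, a) =
    c * truncated_return M pi r n (s, a) + truncated_return M pi r' n (s, a).
  rewrite /truncated_return mulrCA -mulrDr; congr (_ * _).
  rewrite big_distrr -big_split; apply: eq_bigr => i _ /=.
  rewrite (_ : mean_reward _ _ _ =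
     (fun x => c * mean_reward M pi r x + mean_reward M pi r' x)).
    by rewrite kernel_op_lin; ring.
  by apply/funext => x; exact: fmean_lin.
under eq_cvg do rewrite trE.
by apply: cvgD; [apply: cvgMl_tmp|]; exact: cvg_qvalue.
Qed.

Lemma value0_lin pi c r r' :
  value0 M pi (fun y => c * r y + r' y) = c * value0 M pi r + value0 M pi r'.
Proof.
rewrite !value0E -fmean_lin; apply: eq_fmean => s.
by rewrite /value -fmean_lin; apply: eq_fmean => a; exact: qvalue_lin.
Qed.

Lemma value0_cst0 pi : value0 M pi (fun=> 0) = 0.
Proof.
have := value0_lin pi 1 (fun=> 0) (fun=> 0).
rewrite (_ : (fun _ => _) = (fun=> 0)); last by apply/funext => y; ring.
lra.
Qed.

Lemma value0_sum pi (I : Type) (s : seq I) (P : pred I) c (r : I -> reward R S A) :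
  value0 M pi (fun y => c * \sum_(i <- s | P i) r i y) =
  c * \sum_(i <- s | P i) value0 M pi (r i).
Proof.
rewrite (_ : (fun _ => _) = (fun y => c * (\sum_(i <- s | P i) r i y) + 0)); last first.
  by apply/funext => y; rewrite addr0.
rewrite (value0_lin _ _ (fun y => \sum_(i <- s | P i) r i y) (fun=> 0)).
rewrite value0_cst0 addr0; congr (_ * _).
elim: s => [|i s IH].
  rewrite big_nil -[RHS](value0_cst0 pi); congr value0.
  by apply/funext => y; rewrite big_nil.
rewrite big_cons -IH; case: ifP => Pi; last first.
  by congr value0; apply/funext => y; rewrite big_cons Pi.
rewrite -[X in X + _]mul1r -value0_lin; congr value0.
by apply/funext => y; rewrite big_cons Pi mul1r.
Qed.

Lemma value0_le pi r U : (forall y, r y <= U) -> value0 M pi r <= U.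
Proof.
move=> rU; rewrite value0E -(fmean_cst (initial M) U) ler_fmean // => s.
rewrite -[leRHS](fmean_cst (pi s)) ler_fmean // => a; exact: qvalue_le.
Qed.

Lemma value0_bounded pi r U : reward_bounded U r -> `|value0 M pi r| <= U.
Proof.
move=> rU; rewrite ler_norml; apply/andP; split; last first.
  by apply: value0_le => y; have := rU y; rewrite ler_norml => /andP[].
(* The lower bound is the upper bound for the reward [-1 * r + 0]. *)
rewrite lerNl -[leLHS]addr0 -(value0_cst0 pi) -mulN1r -value0_lin.
apply: value0_le => y; have := rU y; rewrite ler_norml => /andP[]; lra.
Qed.

(* The sums [D s] over the rounds of [value s pi - value s (pi_ t)] satisfy
   [D s <= c + discount * max D], as the Bellman equations show. *)
Lemma value0_regret T pi (pi_ : 'I_T -> policy R S A) (r_ : 'I_T -> reward R S A) c :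
  (forall s a, \sum_(t < T) advantage M s a (pi_ t) (r_ t) <= c) ->
  \sum_(t < T) (value0 M pi (r_ t) - value0 M (pi_ t) (r_ t)) <= c / (1 - g).
Proof.
move=> cH.
pose D s := \sum_(t < T) (value M s pi (r_ t) - value M s (pi_ t) (r_ t)).
have DE s : D s = fmean (pi s) (fun a =>
    \sum_(t < T) advantage M s a (pi_ t) (r_ t) + g * fmean (transition M s a) D).
  rewrite /D.
  transitivity (\sum_(t < T) fmean (pi s) (fun a => advantage M s a (pi_ t) (r_ t) +
     g * fmean (transition M s a)
          (fun s' => value M s' pi (r_ t) - value M s' (pi_ t) (r_ t)))).
    apply: eq_bigr => t _.
    rewrite -[X in _ - X](fmean_cst (pi s)) {1}/value -/(fmean _ _).
    rewrite -mulN1r addrC -fmean_lin; apply: eq_fmean => a.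
    (* By [mean_rewardE] the immediate reward is the same under [pi] and [pi_ t]; it cancels, and
       the action values differ only by the discounted values at the next state. *)
    rewrite /advantage !qvalue_bellman !mean_rewardE.
    rewrite (eq_fmean (transition M s a)
       (f := fun s' => value M s' pi (r_ t) - value M s' (pi_ t) (r_ t))
       (g := fun s' => -1 * value M s' (pi_ t) (r_ t) + value M s' pi (r_ t))).
      rewrite fmean_lin; ring.
    by move=> s'; ring.
  rewrite /fmean exchange_big; apply: eq_bigr => a _ /=.
  rewrite -big_distrr big_split /=; congr (_ * (_ + _)).
  rewrite -big_distrr exchange_big /=; congr (_ * _).
  by apply: eq_bigr => s' _; rewrite -big_distrr.
have -> : \sum_(t < T) (value0 M pi (r_ t) - value0 M (pi_ t) (r_ t)) =
    fmean (initial M) D.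
  rewrite /fmean /D; under [RHS]eq_bigr do rewrite big_distrr.
  rewrite exchange_big; apply: eq_bigr => t _ /=.
  rewrite !value0E /fmean -sumrB; apply: eq_bigr => s _; ring.
rewrite -[leRHS](fmean_cst (initial M)) ler_fmean //.
apply: discounted_le => // m Dm s.
rewrite DE -[leRHS](fmean_cst (pi s)) ler_fmean // => a.
rewrite lerD // ler_wpM2l //.
by rewrite -[leRHS](fmean_cst (transition M s a)) ler_fmean.
Qed.

End value_theory.

(** * Selection of the k worst rewards *)

Lemma sum_sorted_le (R : realDomainType) (N k : nat) (v : 'I_N -> R)
    (s s' : 'S_N) : (k <= N)%N ->
  (forall i j : 'I_N, (i <= j)%N -> v (s i) <= v (s j)) ->
  \sum_(j < N | (j < k)%N) v (s j) <= \sum_(j < N | (j < k)%N) v (s' j).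
Proof.
case: k => [|k] kN vs; first by rewrite !big_pred0.
(* The largest selected value. Both sums have [k.+1] terms, so subtracting [m] from each preserves
   the comparison; it makes the selected terms nonpositive and all the others nonnegative. *)
pose m := v (s (Ordinal kN)).
suff : \sum_(j < N | (j < k.+1)%N) (v (s j) - m) <=
       \sum_(j < N | (j < k.+1)%N) (v (s' j) - m).
  by rewrite !sumrB lerD2r.
(* After reindexing, the i-th summand on either side, when present, concerns the same item [s i], so
   the sums compare term by term. *)
rewrite [leRHS](reindex_inj (@perm_inj _ (s * s'^-1)%g)) /=.
rewrite big_mkcond [leRHS]big_mkcond; apply: ler_sum => i _.
rewrite permM permKV; case: (ltnP i k.+1) => ik.
  by have := vs i (Ordinal kN) ik; case: ifP; rewrite ?subr_le0.
by have := vs (Ordinal kN) i (ltnW ik); case: ifP; rewrite ?subr_ge0.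
Qed.

Section kofn_theory.
Context {R : realType} {S A : finType} (M : mdp R S A) (k N : nat).
Hypotheses (k_ge1 : (1 <= k)%N) (k_leN : (k <= N)%N).
Variable rule : N.-tuple R -> N.-tuple (reward R S A) -> 'S_N.
Hypothesis ruleP : sorting_rule rule.
Implicit Types (pi : policy R S A) (rs : N.-tuple (reward R S A)).

Let val_kofn pi pi' rs :
  value0 M pi (kofn_reward M k rule pi' rs) = k%:R^-1 *
  \sum_(j < N | (j < k)%N)
    value0 M pi (tnth rs (rule [tuple of map (value0 M pi') rs] rs j)).
Proof.
exact: (value0_sum M pi (index_enum 'I_N) (fun j : 'I_N => (j < k)%N) k%:R^-1
  (fun j => tnth rs (rule [tuple of map (value0 M pi') rs] rs j))).
Qed.

Lemma value0_kofn_le pi pi' rs :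
  value0 M pi (kofn_reward M k rule pi rs) <=
  value0 M pi (kofn_reward M k rule pi' rs).
Proof.
rewrite !val_kofn ler_wpM2l ?invr_ge0 ?ler0n //.
apply: (sum_sorted_le (v := fun i => value0 M pi (tnth rs i))) => // i j ij.
by have := ruleP.1 [tuple of map (value0 M pi) rs] rs i j ij; rewrite !tnth_map.
Qed.

Lemma kofn_reward_bounded U pi rs :
  (forall i, reward_bounded U (tnth rs i)) ->
  reward_bounded U (kofn_reward M k rule pi rs).
Proof.
move=> rsU y; rewrite /kofn_reward.
rewrite normrM ger0_norm ?invr_ge0 ?ler0n //.
rewrite mulrC ler_pdivrMr ?ltr0n //.
apply: le_trans (ler_norm_sum _ _ _) _.
apply: (@le_trans _ _ (\sum_(j < N | (j < k)%N) U)).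
  by apply: ler_sum => j _; exact: rsU.
by rewrite -(big_ord_widen _ (fun=> U)) // sumr_const card_ord mulr_natr.
Qed.

End kofn_theory.

(** * Measurability in the policy and the reward *)

Section measurability.
Context {R : realType} {S A : finType} (M : mdp R S A).
Context d (T : measurableType d).

(** Policies carry no sigma-algebra, so measurability is asked of each action probability. *)
Definition measurable_policy (pi_ : T -> policy R S A) : Prop :=
  forall s a, measurable_fun setT (fun t => pi_ t s a).

Lemma measurable_eval (r_ : T -> reward R S A) y :
  measurable_fun setT r_ -> measurable_fun setT (fun t => r_ t y).
Proof.
by move=> mr; apply: (measurableT_comp (measurable_rvec_eval y)).
Qed.

Section qvalue.
Variables (pi_ : T -> policy R S A) (r_ : T -> reward R S A).
Hypotheses (mpi : measurable_policy pi_) (mr : measurable_fun setT r_).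

Lemma measurable_truncated_return n x :
  measurable_fun setT (fun t => truncated_return M (pi_ t) (r_ t) n x).
Proof.
apply: measurable_funM => //; apply: measurable_sum => i.
apply: measurable_funM => //; elim: (nat_of_ord i) x => [|{}i IH] [s a].
  under eq_fun do rewrite [iter _ _ _]/= mean_rewardE /fmean.
  apply: measurable_sum => s'; apply: measurable_funM => //.
  exact: measurable_eval.
under eq_fun do rewrite iterS kernel_opE /fmean.
apply: measurable_sum => s'; apply: measurable_funM => //.
apply: measurable_sum => a'; apply: measurable_funM; first exact: mpi.
exact: IH.
Qed.

Lemma measurable_qvalue s a :
  measurable_fun setT (fun t => qvalue M s a (pi_ t) (r_ t)).
Proof.
apply: (@measurable_fun_cvg _ _ _ _
  (fun n t => truncated_return M (pi_ t) (r_ t) n (s, a))) => [n|t _].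
  exact: measurable_truncated_return.
exact: cvg_qvalue.
Qed.

Lemma measurable_value0 : measurable_fun setT (fun t => value0 M (pi_ t) (r_ t)).
Proof.
under eq_fun do rewrite value0E /fmean.
apply: measurable_sum => s; apply: measurable_funM => //.
apply: measurable_sum => a; apply: measurable_funM; first exact: mpi.
exact: measurable_qvalue.
Qed.

End qvalue.

Lemma measurable_kofn_reward k N (rule : N.-tuple R -> N.-tuple (reward R S A) -> 'S_N)
    (pi_ : T -> policy R S A) (rs_ : T -> N.-tuple (reward R S A)) :
  sorting_rule rule -> measurable_policy pi_ -> measurable_fun setT rs_ ->
  measurable_fun setT (fun t => kofn_reward M k rule (pi_ t) (rs_ t)).
Proof.
move=> ruleP mpi mrs; have mrsi i : measurable_fun setT (fun t => tnth (rs_ t) i).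
  exact: (measurableT_comp (measurable_tnth i)).
pose vs t := [tuple of map (value0 M (pi_ t)) (rs_ t)].
have mvs : measurable_fun setT vs.
  apply/measurable_fun_tnthP => i.
  rewrite (_ : _ \o _ = fun t => value0 M (pi_ t) (tnth (rs_ t) i)).
    exact: measurable_value0.
  by apply/funext => t; rewrite /= tnth_map.
pose B s := [set t | rule (vs t) (rs_ t) = s].
have mB s : measurable (B s).
  have := measurable_fun_pair mvs mrs measurableT (ruleP.2 s).
  by rewrite setTI.
apply: measurable_fun_rvecP => y.
(* The sorting permutation varies with [t] but takes finitely many values; it is constant on each
   [B s], measurable by the second clause of [sorting_rule]. *)
rewrite (_ : (fun t => _) = (fun t => k%:R^-1 * \sum_(s : 'S_N) \1_(B s) t *
    \sum_(j < N | (j < k)%N) tnth (rs_ t) (s j) y)).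
  apply: measurable_funM => //; apply: measurable_sum => s.
  apply: measurable_funM; first by apply: measurable_indic; exact: mB.
  under eq_fun do rewrite big_mkcond.
  apply: measurable_sum => j; case: (j < k)%N => //.
  exact: (measurable_eval y (mrsi (s j))).
apply/funext => t; rewrite /kofn_reward -/(vs t); congr (_ * _); symmetry.
rewrite (bigD1 (rule (vs t) (rs_ t))) //= indicE mem_set // mul1r.
rewrite [X in _ + X]big1 ?addr0 // => s st; rewrite indicE memNset ?mul0r //= => sE.
by rewrite sE eqxx in st.
Qed.

End measurability.

(** * Exponential inequalities *)

Section exponential.
Context {R : realType}.
Implicit Types x y b l : R.

Lemma fact_double_ge n : (2 ^ n * n`! <= (n.*2)`!)%N.
Proof.
elim: n => [//|n IH]; rewrite doubleS !factS expnS.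
rewrite mulnACA mul2n leq_mul2l /=.
by apply: leq_trans IH _; rewrite leq_pmull.
Qed.

(** Power series are compared: the odd terms of cosh cancel, and its term of degree 2m is at most
    the m-th term on the right because 2^m m! <= (2m)!. *)
Lemma cosh_le x : (expR x + expR (- x)) / 2 <= expR (x ^+ 2 / 2).
Proof.
pose b j : R := exp_coeff (x ^+ 2 / 2) j.
have b0 j : 0 <= b j by rewrite /b exp_coeff_ge0 // divr_ge0 ?sqr_ge0.
pose a i : R := exp_coeff x i + exp_coeff (- x) i.
(* [uphalf n] counts the even exponents below [n]. *)
have ab n : \sum_(i < n) a i <= 2 * \sum_(j < uphalf n) b j.
  elim: n => [|n IH]; first by rewrite !big_ord0 mulr0.
  rewrite big_ord_recr /=; move: IH; rewrite uphalf_half.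
  have [on|en] := boolP (odd n).
    rewrite add1n => IH; rewrite [a n]/a /exp_coeff /= exprNn -signr_odd on expr1.
    by rewrite mulN1r mulNr subrr addr0.
  rewrite add0n big_ord_recr /= mulrDr => /le_trans IH; rewrite lerD ?IH //.
  rewrite /a /b /exp_coeff /= exprNn -signr_odd (negbTE en) expr0 mul1r.
  have : n = n./2.*2 by rewrite -[LHS]odd_double_half (negbTE en).
  move: (n./2) => m ->.
  suff : x ^+ m.*2 / (m.*2)`!%:R <= (x ^+ 2 / 2) ^+ m / m`!%:R by lra.
  rewrite -mul2n exprM expr_div_n -mulrA ler_wpM2l //; first by rewrite exprn_ge0 // sqr_ge0.
  rewrite -invfM lef_pV2 ?posrE ?mulr_gt0 ?exprn_gt0 ?ltr0n ?fact_gt0 //.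
  by rewrite -natrX -natrM ler_nat mul2n fact_double_ge.
have bE m : \sum_(j < m) b j <= expR (x ^+ 2 / 2).
  rewrite -(big_mkord xpredT b); apply: nondecreasing_cvgn_le.
    by apply/nondecreasing_seqP => n; rewrite /series /= big_nat_recr //= lerDl; exact: b0.
  exact: is_cvg_series_exp_coeff.
rewrite ler_pdivrMr // mulrC.
have cvg_a : \sum_(i < n) a i @[n --> \oo] --> expR x + expR (- x).
  rewrite (_ : (fun n => _) = series (exp_coeff x) \+ series (exp_coeff (- x))).
    by apply: cvgD; exact: is_cvg_series_exp_coeff.
  by apply/funext => n; rewrite /series /= !big_mkord -big_split.
rewrite -(cvg_lim _ cvg_a) //; apply: limr_le; first exact: cvgP cvg_a.
by apply: nearW => n; apply: le_trans (ab n) _; rewrite ler_wpM2l.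
Qed.

(* The chord of [expR (l * _)] over [- b, b]; for [b = 0] the slope is the junk
   value [0], which is harmless as then [f = 0]. *)
Lemma expR_chord l b (f : R) : `|f| <= b ->
  expR (l * f) <= (expR (l * b) + expR (- (l * b))) / 2 +
                  (expR (l * b) - expR (- (l * b))) / 2 / b * f.
Proof.
move=> fb; have b0 : 0 <= b := le_trans (normr_ge0 f) fb.
have [b_eq0|b_neq0] := eqVneq b 0.
  have -> : f = 0 by apply/normr0_eq0/eqP; rewrite eq_le normr_ge0 -b_eq0 fb.
  by rewrite b_eq0 !mulr0 oppr0 expR0 addr0; lra.
have b_gt0 : 0 < b by rewrite lt_def b_neq0.
(* Convexity through the tangent of [expR] at [l * f], used at [l * b] and [- (l * b)]. The weights
   [(b + f) / (2 * b)] and [(b - f) / (2 * b)] average [b] and [- b] to [f], which cancels the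
   slope. *)
have tangent y : expR (l * f) * (1 + (y - l * f)) <= expR y.
  rewrite -{2}(subrK (l * f) y) expRD mulrC.
  by rewrite ler_wpM2r ?expR_ge0 // expR_ge1Dx.
have t1 := tangent (l * b); have t2 := tangent (- (l * b)).
have w1 : 0 <= (b + f) / (2 * b).
  by rewrite divr_ge0 ?mulr_ge0 //; move: fb; rewrite ler_norml => /andP[]; lra.
have w2 : 0 <= (b - f) / (2 * b).
  by rewrite divr_ge0 ?mulr_ge0 //; move: fb; rewrite ler_norml => /andP[]; lra.
have := lerD (ler_wpM2l w1 t1) (ler_wpM2l w2 t2).
set e := expR (l * f); set e1 := expR (l * b); set e2 := expR (- (l * b)).
have -> : (b + f) / (2 * b) * (e * (1 + (l * b - l * f))) +
  (b - f) / (2 * b) * (e * (1 + (- (l * b) - l * f))) = e by field.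
by move=> /le_trans; apply; rewrite le_eqVlt; apply/orP; left; apply/eqP; field.
Qed.

End exponential.

(** * Almost surely bounded variables: Hoeffding's lemma and Chernoff's bound *)

Section bounded_variables.
Context d (T : measurableType d) {R : realType} (Q : probability T R).
Implicit Types (f : T -> R) (b l : R).

Lemma ae_mono (A B : T -> Prop) : (forall x, A x -> B x) ->
  {ae Q, forall x, A x} -> {ae Q, forall x, B x}.
Proof. by move=> AB; apply: negligibleS => x /=; apply: contra_not; exact: AB. Qed.

Lemma ae_bounded_integrable f b : measurable_fun setT f ->
  {ae Q, forall x, `|f x| <= b} -> Q.-integrable setT (EFin \o f).
Proof.
move=> mf fb; apply/integrableP; split; first exact/measurable_EFinP.
apply: (@le_lt_trans _ _ (\int[Q]_x (cst `|b|%:E x))%E); last first.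
  by rewrite integral_cst //= probability_setT mule1 ltry.
apply: ae_ge0_le_integral => //.
- by apply: measurableT_comp => //; exact/measurable_EFinP.
- by move=> x _; rewrite lee_fin.
- apply: ae_mono fb => x fx _ /=; rewrite lee_fin.
  exact: le_trans fx (ler_norm _).
Qed.

Lemma ae_bounded_integral f b : measurable_fun setT f ->
  {ae Q, forall x, `|f x| <= b} -> `|fine (\int[Q]_x (f x)%:E)%E| <= b.
Proof.
move=> mf fb; have intf := ae_bounded_integrable mf fb.
have ifin := integrable_fin_num measurableT intf.
rewrite -lee_fin -abse_EFin fineK //.
apply: le_trans (le_abse_integral _ _ _) _ => //; first exact/measurable_EFinP.
have -> : b%:E = (\int[Q]_x (cst b%:E x))%E.
  by rewrite integral_cst //= probability_setT mule1.
have b0 : 0 <= b.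
  rewrite leNgt; apply/negP => b0.
  suff : Q setT = 0%E by rewrite probability_setT => /eqP; rewrite onee_eq0.
  apply/negligibleP => //; apply: negligibleS fb => x _ /=.
  by apply/negP; rewrite -ltNge (lt_le_trans b0).
apply: ae_ge0_le_integral => //.
- by apply: measurableT_comp => //; exact/measurable_EFinP.
- by apply: ae_mono fb => x fx _ /=; rewrite lee_fin.
Qed.

Lemma integral_centered f1 f2 (c1 c2 : R) :
  Q.-integrable setT (EFin \o f1) -> Q.-integrable setT (EFin \o f2) ->
  (\int[Q]_x (f1 x)%:E = c1%:E)%E -> (\int[Q]_x (f2 x)%:E = c2%:E)%E ->
  (\int[Q]_x ((c1 - c2) - (f1 x - f2 x))%:E = 0)%E.
Proof.
move=> i1 i2 e1 e2; under eq_integral do rewrite EFinB.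
have i12 : Q.-integrable setT (fun x => (f1 x - f2 x)%:E).
  rewrite (_ : (fun x => _) = ((EFin \o f1) \- (EFin \o f2))%E).
    exact: integrableB.
  by apply/funext => x; rewrite /= EFinB.
rewrite integralB //; last exact: finite_measure_integrable_cst.
rewrite integral_cst //= probability_setT mule1.
under [X in (_ - X)%E]eq_integral do rewrite EFinB.
by rewrite integralB // e1 e2 -!EFinB subrr.
Qed.

(** Integrating the chord of [expR_chord] kills its linear term, as [f] is centered, and leaves
    cosh(l b), which [cosh_le] bounds. *)
Lemma hoeffding_mgf f b l : measurable_fun setT f ->
  {ae Q, forall x, `|f x| <= b} -> (\int[Q]_x (f x)%:E = 0)%E ->
  (\int[Q]_x (expR (l * f x))%:E <= (expR ((l * b) ^+ 2 / 2))%:E)%E.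
Proof.
move=> mf fb f0.
pose c : R := (expR (l * b) + expR (- (l * b))) / 2.
pose e : R := (expR (l * b) - expR (- (l * b))) / 2 / b.
apply: (@le_trans _ _ c%:E); last by rewrite lee_fin; exact: cosh_le.
have intf := ae_bounded_integrable mf fb.
have -> : (c%:E = \int[Q]_x (cst c%:E x + e%:E * (f x)%:E))%E.
  rewrite integralD //; last 2 first.
  - exact: finite_measure_integrable_cst.
  - exact: integrableZl.
  by rewrite integralZl // f0 mule0 adde0 integral_cst //= probability_setT mule1.
pose h x : R := c + e * f x.
have mh : measurable_fun setT h.
  by apply: measurable_funD => //; exact: measurable_funM.
have hE : {ae Q, forall x, expR (l * f x) <= h x}.
  by apply: ae_mono fb => x fx; exact: expR_chord.
(* The comparison of integrals wants integrands nonnegative everywhere, while [h] is known to be so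
   only almost everywhere; the absolute value is removed afterwards. *)
apply: (@le_trans _ _ (\int[Q]_x (`|h x|%:E))%E).
  apply: ae_ge0_le_integral => //.
  - apply/measurable_EFinP. apply: measurableT_comp; first exact: measurable_expR.
    exact: measurable_funM.
  - by apply/measurable_EFinP; exact: measurableT_comp.
  - apply: ae_mono hE => x hx _; rewrite lee_fin.
    exact: le_trans hx (ler_norm _).
rewrite le_eqVlt; apply/orP; left; apply/eqP; apply: ae_eq_integral => //.
- by apply/measurable_EFinP; exact: measurableT_comp.
- exact/measurable_EFinP.
- apply: ae_mono hE => x hx _ /=; rewrite ger0_norm //.
  exact: le_trans (expR_ge0 _) hx.
Qed.

(** Chernoff's bound: where [e < f x], the integrand is at least [expR (l * e)]. *)
Lemma markov_mgf f l e c : 0 <= l -> measurable_fun setT f ->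
  (\int[Q]_x (expR (l * f x))%:E <= (expR c)%:E)%E ->
  (Q [set x | (e < f x)%R] <= (expR (c - l * e))%:E)%E.
Proof.
move=> l0 mf fc.
have mB : measurable [set x | (e < f x)%R].
  rewrite (_ : [set x | _] = f @^-1` `]e, +oo[%classic).
    by rewrite -[X in measurable X]setTI; exact: mf.
  by apply/seteqP; split => x /=; rewrite in_itv /= andbT.
rewrite expRD expRN EFinM lee_pdivlMr ?expR_gt0 //; apply: le_trans fc.
rewrite muleC -(setIT [set x | (e < f x)%R]) -integral_indic // -integralZl //; last first.
  exact: integrable_indic.
apply: ge0_le_integral => //.
- by apply/measurable_EFinP; apply: measurable_funM => //; exact: measurable_indic.
- apply/measurable_EFinP; apply: measurableT_comp; first exact: measurable_expR.
  exact: measurable_funM.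
move=> x _; rewrite -EFinM lee_fin indicE.
case: (boolP (x \in _)) => [|_]; last by rewrite mulr0 expR_ge0.
by rewrite inE /= => ex; rewrite mulr1 ler_expR ler_wpM2l // ltW.
Qed.

End bounded_variables.

(** Tonelli's measurability result concerns nonnegative functions; the integral is the difference of
    those of the positive and negative parts. *)
Lemma measurable_fine_integral d d' (T : measurableType d)
    (Y : measurableType d') (R : realType) (Q : probability Y R)
    (F : T * Y -> R) : measurable_fun setT F ->
  measurable_fun setT (fun t => fine (\int[Q]_y (F (t, y))%:E)%E).
Proof.
move=> mF; have mFE : measurable_fun setT (EFin \o F) by exact/measurable_EFinP.
apply: measurableT_comp; first exact: fine_measurable.
under eq_fun do rewrite integralE.
apply: emeasurable_funB.
  rewrite (_ : (fun t => _) = fubini_F Q ((EFin \o F)^\+)%E).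
    apply: measurable_fun_fubini_tonelli_F; first exact: measurable_funepos.
    by move=> z; exact: funepos_ge0.
  by apply/funext => t; apply: eq_integral => y _; rewrite !funeposE.
rewrite (_ : (fun t => _) = fubini_F Q ((EFin \o F)^\-)%E).
  apply: measurable_fun_fubini_tonelli_F; first exact: measurable_funeneg.
  by move=> z; exact: funeneg_ge0.
by apply/funext => t; apply: eq_integral => y _; rewrite !funenegE.
Qed.

Lemma measurable_rcons d d' (T : measurableType d) (Y : measurableType d') n
    (g : T -> n.-tuple Y) (f : T -> Y) :
  measurable_fun setT g -> measurable_fun setT f ->
  measurable_fun setT (fun t => [tuple of rcons (g t) (f t)]).
Proof.
move=> mg mf; apply/measurable_fun_tnthP => i.
case: (ltnP i n) => ni.
  rewrite (_ : _ \o _ = (fun t => tnth (g t) (Ordinal ni))).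
    exact: (measurableT_comp (measurable_tnth _)).
  apply/funext => t /=; rewrite !(tnth_nth (f t)) /= nth_rcons size_tuple ni //.
rewrite (_ : _ \o _ = f) //; apply/funext => t /=.
rewrite (tnth_nth (f t)) /= nth_rcons size_tuple ltnNge ni /=.
by case: ifP.
Qed.

Lemma measurable_reward_bounded (R : realType) (S A : finType) (U : R) :
  measurable [set r : reward R S A | reward_bounded U r].
Proof.
have -> : [set r : reward R S A | reward_bounded U r] =
    \bigcap_(y in [set: (S * A * S)%type])
      ((fun r : reward R S A => r y) @^-1` `[- U, U]%classic).
  apply/seteqP; split => r /= rU y; first by rewrite /= in_itv /= -ler_norml.
  by have := rU y I; rewrite /= in_itv /= -ler_norml.
apply: fin_bigcap_measurable => // y _; rewrite -[X in measurable X]setTI.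
exact: measurable_rvec_eval.
Qed.

Lemma ae_sample_bounded (R : realType) (S A : finType) (U : R)
    (rho : probability (reward R S A) R) N :
  rho [set r | reward_bounded U r] = 1%E ->
  {ae power_prob rho N, forall rs, forall i, reward_bounded U (tnth rs i)}.
Proof.
move=> rhoU; have mB := @measurable_reward_bounded R S A U.
have mBs : measurable [set rs : N.-tuple (reward R S A) |
    forall i, reward_bounded U (tnth rs i)].
  rewrite (_ : [set _ | _] = \bigcap_(i in [set: 'I_N])
      ((fun rs : N.-tuple (reward R S A) => tnth rs i) @^-1`
        [set r | reward_bounded U r])).
    apply: fin_bigcap_measurable => // i _; rewrite -[X in measurable X]setTI.
    exact: measurable_tnth.
  by apply/seteqP; split => rs /= h; [move=> i _|move=> i]; apply: h.
have Q1 : power_prob rho N [set rs | forall i, reward_bounded U (tnth rs i)] = 1%E.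
  by rewrite (power_probE rho (A := fun=> [set r | reward_bounded U r])) // big1.
have Q0 := probability_setC (power_prob rho N) mBs; rewrite Q1 subee // in Q0.
by apply/negligibleP; [exact: measurableC | exact: Q0].
Qed.

(** * Learner histories and the noise along them *)

Section histories.
Context {R : realType} {S A : finType} (M : mdp R S A) (k N : nat).
Variable rule : N.-tuple R -> N.-tuple (reward R S A) -> 'S_N.
Hypothesis ruleP : sorting_rule rule.
Variable L : learners R S A.
Hypothesis L_meas : measurable_learners L.

Definition history : Type := S -> seq (rvec R A).

Definition history_policy (h : history) : policy R S A := fun s => L s (h s).

Definition history_next (h : history) (rs : N.-tuple (reward R S A)) : history :=
  cfr_update M L h (kofn_reward M k rule (history_policy h) rs).

Definition history_after (x : nat -> N.-tuple (reward R S A)) (t : nat) : history :=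
  foldl history_next (fun=> [::]) (mkseq x t).

(** Trades the list of past rewards for a state updated by one sample at a time, from which an
    induction can peel off the first sample. *)
Lemma kofn_cfr_policyE x t :
  kofn_cfr_policy M k rule L x t = history_policy (history_after x t).
Proof.
rewrite /kofn_cfr_policy /cfr_policy /history_policy.
suff -> : cfr_history M L (kofn_cfr_rewards M k rule L x t) = history_after x t by [].
elim: t => [//|t IH].
rewrite /history_after /mkseq -addn1 iotaD map_cat foldl_cat /= addn1 add0n.
by rewrite -/(mkseq x t) -/(history_after x t) -IH /cfr_history foldl_rcons.
Qed.

Section measurable_histories.
Context d (T : measurableType d).

(* A random history is measurable if, at every state, its length is constant and
   the tuple of its entries is measurable. *)
Definition measurable_history (H : T -> history) : Prop :=
  forall s, exists n (g : T -> n.-tuple (rvec R A)),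
    measurable_fun setT g /\ forall t, H t s = g t.

Lemma measurable_history_cst (h : history) : measurable_history (fun=> h).
Proof.
by move=> s; exists (size (h s)), (fun=> in_tuple (h s)).
Qed.

Lemma measurable_history_policy (H : T -> history) :
  measurable_history H -> measurable_policy (fun t => history_policy (H t)).
Proof.
move=> mH s a; have [n [g [mg Hg]]] := mH s.
rewrite (_ : (fun t => _) = (fun h : n.-tuple (rvec R A) => L s h a) \o g).
  by apply: measurableT_comp; [exact: L_meas | exact: mg].
by apply/funext => t; rewrite /= /history_policy Hg.
Qed.

Lemma measurable_history_next (H : T -> history)
    (rs_ : T -> N.-tuple (reward R S A)) :
  measurable_history H -> measurable_fun setT rs_ ->
  measurable_history (fun t => history_next (H t) (rs_ t)).
Proof.
move=> mH mrs s; have [n [g [mg Hg]]] := mH s.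
have mpi := measurable_history_policy mH.
exists n.+1, (fun t => [tuple of rcons (g t) (fun a => qvalue M s a
  (history_policy (H t)) (kofn_reward M k rule (history_policy (H t)) (rs_ t)))]).
split; last by move=> t; rewrite /history_next /cfr_update /= Hg.
apply: measurable_rcons => //; apply: measurable_fun_rvecP => a.
apply: measurable_qvalue => //.
exact: measurable_kofn_reward.
Qed.

Lemma measurable_history_after (x : T -> nat -> N.-tuple (reward R S A)) t :
  (forall i, measurable_fun setT (fun w => x w i)) ->
  measurable_history (fun w => history_after (x w) t).
Proof.
move=> mx; elim: t => [|t IH]; first exact: measurable_history_cst.
rewrite (_ : (fun w => _) = fun w => history_next (history_after (x w) t) (x w t)).
  exact: measurable_history_next.
apply/funext => w; rewrite /history_after /mkseq -addn1 iotaD map_cat foldl_cat.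
by rewrite /= add0n.
Qed.

End measurable_histories.

Variable rho : probability (reward R S A) R.
Local Notation Q := (power_prob rho N).

(* The mean m(pi, pi') of the introduction. *)
Definition cross_value (pi pi' : policy R S A) : R :=
  fine (\int[Q]_rs (value0 M pi (kofn_reward M k rule pi' rs))%:E)%E.

Lemma measurable_const_policy d (T : measurableType d) (pi : policy R S A) :
  measurable_policy (fun _ : T => pi).
Proof. by move=> s a; exact: measurable_cst. Qed.

Lemma measurable_cross_value d (T : measurableType d) (pi_ pi'_ : T -> policy R S A) :
  measurable_policy pi_ -> measurable_policy pi'_ ->
  measurable_fun setT (fun t => cross_value (pi_ t) (pi'_ t)).
Proof.
move=> mpi mpi'.
apply: (@measurable_fine_integral _ _ _ _ _ Q (fun z : T * N.-tuple (reward R S A) =>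
  value0 M (pi_ z.1) (kofn_reward M k rule (pi'_ z.1) z.2))).
apply: measurable_value0.
  by move=> s a; exact: (measurableT_comp (mpi s a) measurable_fst).
apply: measurable_kofn_reward => //.
by move=> s a; exact: (measurableT_comp (mpi' s a) measurable_fst).
Qed.

Variable U : R.
Hypotheses (k_ge1 : (1 <= k)%N) (k_leN : (k <= N)%N).
Hypothesis rho_bounded : rho [set r | reward_bounded U r] = 1%E.

Lemma measurable_value0_kofn pi pi' :
  measurable_fun setT (fun rs => value0 M pi (kofn_reward M k rule pi' rs)).
Proof.
apply: measurable_value0; first exact: measurable_const_policy.
apply: measurable_kofn_reward => //; exact: measurable_const_policy.
Qed.

Lemma ae_value0_kofn pi pi' :
  {ae Q, forall rs, `|value0 M pi (kofn_reward M k rule pi' rs)| <= U}.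
Proof.
apply: ae_mono (ae_sample_bounded N rho_bounded) => rs rsU.
by apply: value0_bounded; exact: kofn_reward_bounded.
Qed.

Lemma integrable_value0_kofn pi pi' :
  Q.-integrable setT (fun rs => (value0 M pi (kofn_reward M k rule pi' rs))%:E).
Proof.
apply: ae_bounded_integrable (ae_value0_kofn pi pi').
exact: measurable_value0_kofn.
Qed.

Lemma cross_value_bounded pi pi' : `|cross_value pi pi'| <= U.
Proof.
apply: ae_bounded_integral (ae_value0_kofn pi pi').
exact: measurable_value0_kofn.
Qed.

Lemma integral_cross_value pi pi' :
  (\int[Q]_rs (value0 M pi (kofn_reward M k rule pi' rs))%:E =
   (cross_value pi pi')%:E)%E.
Proof.
rewrite /cross_value fineK //; apply: integrable_fin_num => //.
exact: integrable_value0_kofn.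
Qed.

Lemma kofn_valueE pi : kofn_value M k rule rho pi = cross_value pi pi.
Proof.
rewrite /kofn_value /cross_value /kofn_dist integral_pushforward //.
- by apply: measurable_kofn_reward => //; exact: measurable_const_policy.
- apply/measurable_EFinP.
  by apply: (@measurable_value0 _ _ _ _ _ _ (fun=> pi) id).
- exact: integrable_value0_kofn.
Qed.

Lemma kofn_value_le pi pi' : kofn_value M k rule rho pi <= cross_value pi pi'.
Proof.
rewrite kofn_valueE -lee_fin.
rewrite -[leLHS](integral_cross_value pi pi) -[leRHS](integral_cross_value pi pi').
apply: (le_integral measurableT (integrable_value0_kofn pi pi)
  (integrable_value0_kofn pi pi')).
by move=> rs _; rewrite lee_fin; exact: value0_kofn_le.
Qed.

Variable pi : policy R S A.

Definition noise (h : history) (rs : N.-tuple (reward R S A)) : R :=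
  let pi' := history_policy h in
  (cross_value pi pi' - cross_value pi' pi') -
  (value0 M pi (kofn_reward M k rule pi' rs) -
   value0 M pi' (kofn_reward M k rule pi' rs)).

(** Unfolds from the first round, with the history as a parameter, so that the later rounds fall
    under the induction hypothesis at the updated history. *)
Fixpoint total_noise (h : history) (rss : seq (N.-tuple (reward R S A))) : R :=
  if rss is rs :: rss' then noise h rs + total_noise (history_next h rs) rss'
  else 0.

(** Each of the four terms lies in [- U, U]: the cross values because samples are bounded almost
    surely, the sampled values because [rs] is bounded. *)
Lemma noise_le h rs : (forall i, reward_bounded U (tnth rs i)) ->
  `|noise h rs| <= 4 * U.
Proof.
move=> rsU.
have vU pi1 : `|value0 M pi1 (kofn_reward M k rule (history_policy h) rs)| <= U.
  by apply: value0_bounded; exact: kofn_reward_bounded.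
have bound (a b c e : R) : `|a| <= U -> `|b| <= U -> `|c| <= U -> `|e| <= U ->
    `|(a - b) - (c - e)| <= 4 * U.
  by rewrite !ler_norml => /andP[? ?] /andP[? ?] /andP[? ?] /andP[? ?]; lra.
by apply: bound; [exact: cross_value_bounded|exact: cross_value_bounded|
  exact: vU|exact: vU].
Qed.

Lemma measurable_noise d (T : measurableType d) (H : T -> history)
    (rs_ : T -> N.-tuple (reward R S A)) :
  measurable_history H -> measurable_fun setT rs_ ->
  measurable_fun setT (fun t => noise (H t) (rs_ t)).
Proof.
move=> mH mrs; have mpi' := measurable_history_policy mH.
have mpi := @measurable_const_policy _ T pi.
have mr : measurable_fun setT (fun t =>
    kofn_reward M k rule (history_policy (H t)) (rs_ t)).
  exact: measurable_kofn_reward.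
apply: measurable_funB; apply: measurable_funB.
- exact: measurable_cross_value.
- exact: measurable_cross_value.
- exact: measurable_value0.
- exact: measurable_value0.
Qed.

Lemma measurable_total_noise d (T : measurableType d) (H : T -> history) n
    (y : T -> n.-tuple (N.-tuple (reward R S A))) :
  measurable_history H -> measurable_fun setT y ->
  measurable_fun setT (fun t => total_noise (H t) (y t)).
Proof.
elim: n H y => [|n IH] H y mH my.
  rewrite (_ : (fun t => _) = cst 0); first exact: measurable_cst.
  by apply/funext => t; rewrite tuple0.
have my0 : measurable_fun setT (fun t => thead (y t)).
  exact: (measurableT_comp (measurable_tnth ord0) my).
rewrite (_ : (fun t => _) = fun t => noise (H t) (thead (y t)) +
   total_noise (history_next (H t) (thead (y t))) [tuple of behead (y t)]).
  apply: measurable_funD; first exact: measurable_noise.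
  apply: (IH (fun t => history_next (H t) (thead (y t)))).
    exact: measurable_history_next.
  exact: (measurableT_comp (measurable_behead (n:=n)) my).
by apply/funext => t; rewrite {1}(tuple_eta (y t)).
Qed.

Lemma integral_noise h : (\int[Q]_rs (noise h rs)%:E = 0)%E.
Proof.
by apply: integral_centered; [exact: integrable_value0_kofn|exact: integrable_value0_kofn|
  exact: integral_cross_value|exact: integral_cross_value].
Qed.

Lemma noise_mgf l h : (\int[Q]_rs (expR (l * noise h rs))%:E <=
  (expR ((l * (4 * U)) ^+ 2 / 2))%:E)%E.
Proof.
apply: hoeffding_mgf; last exact: integral_noise.
  apply: measurable_noise => //; exact: measurable_history_cst.
apply: ae_mono (ae_sample_bounded N rho_bounded) => rs; exact: noise_le.
Qed.

(** By Tonelli the first sample is integrated last. The inner integral over the later samples is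
    bounded by a constant free of [h] and [rs], which factors out, and [noise_mgf] bounds what
    remains. *)
Lemma total_noise_mgf l h n :
  (\int[power_prob Q n]_y (expR (l * total_noise h y))%:E <=
   (expR (n%:R * ((l * (4 * U)) ^+ 2 / 2)))%:E)%E.
Proof.
elim: n h => [|n IH] h.
  rewrite mul0r expR0 (eq_integral (cst 1%E)); last first.
    by move=> y _; rewrite (tuple0 y) /= mulr0 expR0.
  by rewrite integral_cst // mul1e; exact: (@probability_le1 _ _ _ (power_prob Q 0)).
have mtn (h' : history) m : measurable_fun setT
    (fun y : m.-tuple (N.-tuple (reward R S A)) => (expR (l * total_noise h' y))%:E).
  apply/measurable_EFinP; apply: measurableT_comp; first exact: measurable_expR.
  apply: measurable_funM => //.
  by apply: measurable_total_noise => //; exact: measurable_history_cst.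
rewrite /= /distribution ge0_integral_pushforward //; last first.
  exact: mtn.
rewrite preimage_setT fubini_tonelli1 //; last 2 first.
- by apply: measurableT_comp (mtn _ _) _.
- by move=> y /=; rewrite lee_fin expR_ge0.
pose c := expR (n%:R * ((l * (4 * U)) ^+ 2 / 2)).
apply: (@le_trans _ _ (\int[Q]_rs (c%:E * (expR (l * noise h rs))%:E))%E); last first.
  rewrite ge0_integralZl_EFin ?expR_ge0 //.
  - rewrite -natr1 mulrDl expRD mul1r EFinM lee_wpmul2l ?lee_fin ?expR_ge0 //.
    exact: noise_mgf.
  - apply/measurable_EFinP; apply: measurableT_comp; first exact: measurable_expR.
    apply: measurable_funM => //.
    by apply: measurable_noise => //; exact: measurable_history_cst.
have mF : measurable_fun setT
    ((fun y : n.+1.-tuple _ => (expR (l * total_noise h y))%:E) \o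
      @cons_pair _ (N.-tuple (reward R S A)) n).
  by apply: measurableT_comp; [exact: (mtn h n.+1) | exact: measurable_cons_pair].
apply: ge0_le_integral => //.
- by move=> rs _; apply: integral_ge0 => y _; rewrite lee_fin expR_ge0.
- apply: measurable_fun_fubini_tonelli_F; first exact: mF.
  by move=> z /=; rewrite lee_fin expR_ge0.
- apply: measurable_funeM; apply/measurable_EFinP.
  apply: measurableT_comp; first exact: measurable_expR.
  apply: measurable_funM => //.
  by apply: measurable_noise => //; exact: measurable_history_cst.
move=> rs _; rewrite /fubini_F /=.
under eq_integral do rewrite mulrDr expRD EFinM.
rewrite ge0_integralZl_EFin ?expR_ge0 //; last exact: (mtn (history_next h rs) n).
by rewrite muleC lee_wpmul2r ?lee_fin ?expR_ge0 //.
Qed.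

End histories.

(** * Joint law of the samples of the first rounds *)

Section iid_samples.
Context d (Omega : measurableType d) d' (Y : measurableType d') {R : realType}.
Context (P : probability Omega R) (rho : probability Y R) (N : nat).
Variable X : nat * 'I_N -> {RV P >-> Y}.
Hypothesis X_iid : iid rho X.

Definition samples n (w : Omega) : n.-tuple (N.-tuple Y) :=
  [tuple [tuple X (nat_of_ord i, j) w | j < N] | i < n].

Lemma measurable_sample i :
  measurable_fun setT (fun w => [tuple X (i, j) w | j < N]).
Proof.
apply/measurable_fun_tnthP => j; rewrite (_ : _ \o _ = X (i, j)) //.
by apply/funext => w; rewrite /= tnth_mktuple.
Qed.

Lemma measurable_samples n : measurable_fun setT (@samples n).
Proof.
apply/measurable_fun_tnthP => i.
rewrite (_ : _ \o _ = fun w => [tuple X (nat_of_ord i, j) w | j < N]).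
  exact: measurable_sample.
by apply/funext => w; rewrite /= tnth_mktuple.
Qed.

HB.instance Definition _ n :=
  isMeasurableFun.Build _ _ _ _ (@samples n) (@measurable_samples n).

Let box n (A : 'I_n -> 'I_N -> set Y) : set (n.-tuple (N.-tuple Y)) :=
  [set x | forall i j, A i j (tnth (tnth x i) j)].

Let boxes n : set (set (n.-tuple (N.-tuple Y))) :=
  [set E | exists2 A, (forall i j, measurable (A i j)) & E = box A].

Let measurable_slice (A : 'I_N -> set Y) : (forall j, measurable (A j)) ->
  measurable [set y : N.-tuple Y | forall j, A j (tnth y j)].
Proof.
move=> mA; rewrite (_ : [set _ | _] = \bigcap_(j in [set: 'I_N])
    ((fun y : N.-tuple Y => tnth y j) @^-1` A j)).
  apply: fin_bigcap_measurable => // j _; rewrite -[X in measurable X]setTI.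
  exact: measurable_tnth.
by apply/seteqP; split => y /= h; [move=> j _|move=> j]; apply: h.
Qed.

Let measurable_box n (A : 'I_n -> 'I_N -> set Y) :
  (forall i j, measurable (A i j)) -> measurable (box A).
Proof.
move=> mA; rewrite (_ : box A = \bigcap_(i in [set: 'I_n])
    ((fun x : n.-tuple (N.-tuple Y) => tnth x i) @^-1`
      [set y | forall j, A i j (tnth y j)])).
  apply: fin_bigcap_measurable => // i _; rewrite -[X in measurable X]setTI.
  by apply: measurable_tnth => //; exact: measurable_slice.
by apply/seteqP; split => y /= h; [move=> i _|move=> i]; apply: h.
Qed.

Let measurableE_boxes n :
  @measurable _ (n.-tuple (N.-tuple Y)) = <<s @boxes n >>.
Proof.
apply/seteqP; split; last first.
  apply: smallest_sub; first exact: sigma_algebra_measurable.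
  by move=> _ [A mA ->]; exact: measurable_box.
(* The inclusion of sigma-algebras, as measurability of the identity: it is checked entry by entry,
   and the preimage of [C] under one entry is a box with all other sides full. *)
have mid : measurable_fun setT
    (idfun : g_sigma_algebraType (@boxes n) -> n.-tuple (N.-tuple Y)).
  apply/measurable_fun_tnthP => i; apply/measurable_fun_tnthP => j.
  move=> _ C mC; rewrite setTI; apply: sub_sigma_algebra.
  exists (fun i' j' => if (i' == i) && (j' == j) then C else setT).
    by move=> i' j'; case: ifP.
  apply/seteqP; split => x /=.
    by move=> Cx i' j'; case: ifP => // /andP[/eqP -> /eqP ->].
  by move=> /(_ i j); rewrite !eqxx.
by move=> E mE; have := mid measurableT E mE; rewrite setTI.
Qed.

Let box_samples n (A : 'I_n -> 'I_N -> set Y) :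
  (forall i j, measurable (A i j)) ->
  P (@samples n @^-1` box A) = power_prob (power_prob rho N) n (box A).
Proof.
move=> mA.
rewrite (power_probE (power_prob rho N)
  (A := fun i => [set y | forall j, A i j (tnth y j)])); last first.
  by move=> i; exact: measurable_slice.
under eq_bigr do rewrite power_probE //.
(* Independence is stated for finite lists of indices in [nat * 'I_N]: [J] lists those of the first
   [n] rounds, and [D] extends [A] by [setT] to later rounds. *)
pose J := [seq (nat_of_ord i, j) | i <- enum 'I_n, j <- enum 'I_N].
pose D (z : nat * 'I_N) : set Y := if insub z.1 is Some i then A i z.2 else setT.
have mD z : measurable (D z) by rewrite /D; case: insubP.
have DE (i : 'I_n) j : D (nat_of_ord i, j) = A i j.
  by rewrite /D /= valK.
have uJ : uniq J.
  apply: allpairs_uniq; rewrite ?enum_uniq // => -[i j] [i' j'] _ _ /= [].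
  by move=> /val_inj -> ->.
have -> : @samples n @^-1` box A = [set w | forall z, z \in J -> D z (X z w)].
  apply/seteqP; split => w /= h.
    by move=> z /allpairsP[[i j] /= [_ _ ->]]; have := h i j; rewrite DE !tnth_mktuple.
  move=> i j; rewrite !tnth_mktuple -DE; apply: h; apply/allpairsP.
  by exists (i, j); rewrite !mem_enum.
rewrite X_iid.2 // /J big_allpairs_dep big_enum; apply: eq_bigr => i _.
rewrite big_enum; apply: eq_bigr => j _ /=.
by rewrite DE; exact: X_iid.1.
Qed.

(** Independence gives the law on boxes; these are stable under intersection and generate the
    sigma-algebra, so finite measures agreeing on them coincide. *)
Lemma law_samples n (E : set (n.-tuple (N.-tuple Y))) : measurable E ->
  P (@samples n @^-1` E) = power_prob (power_prob rho N) n E.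
Proof.
apply: (measure_unique (@boxes n) (fun=> setT) (@measurableE_boxes n) _ _ _
  (distribution P (@samples n)) (power_prob (power_prob rho N) n)).
- move=> _ _ [A mA ->] [B mB ->]; exists (fun i j => A i j `&` B i j).
    by move=> i j; exact: measurableI.
  apply/seteqP; split => x /=.
    by move=> [Ax Bx] i j; split; [exact: Ax | exact: Bx].
  by move=> h; split => i j; have [] := h i j.
- by move=> _; exists (fun _ _ => setT) => //; apply/seteqP; split.
- by rewrite bigcup_const.
- by move=> _ [A mA ->]; exact: box_samples.
- by move=> _; rewrite (le_lt_trans (probability_le1 _ _)) // ltry.
Qed.

End iid_samples.

(** * Regret along a sample path, and the tail of the noise *)

Section pathwise_regret.
Context {R : realType} {S A : finType} (M : mdp R S A) (k N : nat).
Variable rule : N.-tuple R -> N.-tuple (reward R S A) -> 'S_N.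
Hypothesis ruleP : sorting_rule rule.
Variable L : learners R S A.
Variables (U : R) (C : nat -> R) (rho : probability (reward R S A) R).
Hypotheses (k_ge1 : (1 <= k)%N) (k_leN : (k <= N)%N).
Hypothesis rho_bounded : rho [set r | reward_bounded U r] = 1%E.
Hypothesis C_bound : cfr_regret_bound M L U C.
Variable pi : policy R S A.
Local Notation history_next := (history_next M k rule L).
Local Notation history_after := (history_after M k rule L).
Local Notation noise := (noise M k rule L rho pi).
Local Notation total_noise := (total_noise M k rule L rho pi).

Lemma total_noiseE h (x : nat -> N.-tuple (reward R S A)) T :
  total_noise h (mkseq x T) =
  \sum_(t < T) noise (foldl history_next h (mkseq x t)) (x t).
Proof.
elim: T h x => [|T IH] h x; first by rewrite big_ord0.
have mkseqS n : mkseq x n.+1 = x 0%N :: mkseq (x \o succn) n.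
  by rewrite /mkseq /= -[1%N]addn0 iotaDl -map_comp.
rewrite big_ord_recl mkseqS [LHS]/= IH; congr (_ + _).
by apply: eq_bigr => t _; rewrite lift0 mkseqS.
Qed.

Lemma full_regret_le (x : nat -> N.-tuple (reward R S A)) T : (1 <= T)%N ->
  (forall t i, reward_bounded U (tnth (x t) i)) ->
  full_regret M k rule L rho x T pi <=
  C T / (1 - discount M) + total_noise (fun=> [::]) (mkseq x T).
Proof.
move=> T1 xU.
pose pi_ t := kofn_cfr_policy M k rule L x t.
pose r t := kofn_reward M k rule (pi_ t) (x t).
have rU t : reward_bounded U (r t) by exact: kofn_reward_bounded.
(* Along this path the rewards fed to the learners form a fixed sequence [r], so the policies are
   those of [cfr_regret_bound]. *)
have rE t : kofn_cfr_rewards M k rule L x t = mkseq r t.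
  elim: t => [//|t IH].
  have -> : mkseq r t.+1 = rcons (mkseq r t) (r t).
    by rewrite /mkseq -addn1 iotaD map_cat cats1.
  by rewrite -IH.
have := value0_regret (M := M) pi (T := T) (pi_ := pi_ \o val) (r_ := r \o val) (c := C T).
rewrite /= => /(_ _)/le_trans reg.
have {}reg : \sum_(t < T) (value0 M pi (r t) - value0 M (pi_ t) (r t)) <=
    C T / (1 - discount M).
  apply: reg => // s a; have := C_bound rU T1 s a.
  by apply: le_trans; apply: ler_sum => t _; rewrite /pi_ /kofn_cfr_policy rE.
apply: le_trans (lerD reg (lexx _)); rewrite total_noiseE -big_split /=.
apply: ler_sum => t _; rewrite -/(history_after x t) /noise -kofn_cfr_policyE.
(* The sampled difference cancels against the one inside the noise, leaving [kofn_value] of [pi] to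
   be compared with [cross_value pi (pi_ t)]. *)
rewrite -/(pi_ t) -/(r t) addrC subrK.
rewrite (kofn_valueE M ruleP k_ge1 k_leN rho_bounded (pi_ t)) lerD2r.
exact: (kofn_value_le M ruleP k_ge1 k_leN rho_bounded).
Qed.

(** A crude bound for the case [U = 0], where it makes the noise nonpositive. *)
Lemma total_noise_le (x : nat -> N.-tuple (reward R S A)) T h :
  (forall t i, reward_bounded U (tnth (x t) i)) ->
  total_noise h (mkseq x T) <= T%:R * (4 * U).
Proof.
move=> xU; rewrite total_noiseE.
apply: (@le_trans _ _ (\sum_(t < T) 4 * U)); last first.
  by rewrite sumr_const card_ord -[leLHS]mulr_natl.
apply: ler_sum => t _; apply: le_trans (ler_norm _) _.
by apply: noise_le => //; exact: xU.
Qed.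

Hypothesis L_meas : measurable_learners L.

Lemma measurable_full_regret d (Omega : measurableType d)
    (x : Omega -> nat -> N.-tuple (reward R S A)) T :
  (forall t, measurable_fun setT (fun w => x w t)) ->
  measurable_fun setT (fun w => full_regret M k rule L rho (x w) T pi).
Proof.
move=> mx; apply: measurable_sum => t; apply: measurable_funB => //.
have := measurable_history_policy L_meas
  (measurable_history_after M k ruleP L_meas t mx).
move=> mpi; have := measurable_cross_value M k ruleP rho mpi mpi.
apply: eq_measurable_fun => w _.
by rewrite (kofn_valueE M ruleP k_ge1 k_leN rho_bounded) kofn_cfr_policyE.
Qed.

Lemma noise_tail T (p : R) : (1 <= T)%N -> 0 < U -> 0 < p -> p <= 1 ->
  (power_prob (power_prob rho N) T [set y : T.-tuple _ |
    (4 * U * Num.sqrt (2 * T%:R * ln (1 / p)) < total_noise (fun=> [::]) y)%R]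
   <= p%:E)%E.
Proof.
move=> T1 U0 p0 p1; set a := Num.sqrt _.
have s0 : 0 <= ln (1 / p) by apply: ln_ge0; rewrite ler_pdivlMr // mul1r.
have T0 : 0 < T%:R :> R by rewrite ltr0n.
have a2 : a ^+ 2 = 2 * T%:R * ln (1 / p) by rewrite sqr_sqrtr // !mulr_ge0 // ltW.
(* Minimizes the exponent [T%:R * ((l * (4 * U)) ^+ 2 / 2) - l * (4 * U * a)]; the minimum
   [- (a ^+ 2 / (2 * T%:R))] equals [ln p]. *)
pose l := a / (T%:R * (4 * U)).
have l0 : 0 <= l by rewrite divr_ge0 ?sqrtr_ge0 // !mulr_ge0 // ltW.
have lE : l * (4 * U) = a / T%:R by rewrite /l; field; rewrite !gt_eqF.
have mtn : measurable_fun setT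
    (fun y : T.-tuple (N.-tuple (reward R S A)) => total_noise (fun=> [::]) y).
  by apply: measurable_total_noise => //; exact: measurable_history_cst.
have := total_noise_mgf M ruleP L_meas k_ge1 k_leN rho_bounded pi l (fun=> [::]) T.
move=> /(markov_mgf (4 * U * a) l0 mtn) /le_trans; apply.
rewrite lee_fin -[leRHS]lnK ?posrE // ler_expR.
rewrite (mulrA l (4 * U)) lE -[ln p]opprK -lnV ?posrE // -[p^-1]div1r.
have -> : T%:R * ((a / T%:R) ^+ 2 / 2) - a / T%:R * a = - (a ^+ 2 / (2 * T%:R)).
  by field; rewrite gt_eqF.
by rewrite a2 lerN2 mulrAC divff ?mul1r // mulf_neq0 ?gt_eqF.
Qed.

End pathwise_regret.

Theorem theorem2 (R : realType) (S A : finType) (M : mdp R S A) (U : R)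
  (rho : probability (reward R S A) R)
  (rho_bounded : rho [set r | reward_bounded U r] = 1%E)
  (k N T : nat) (k_ge1 : (1 <= k)%N) (k_leN : (k <= N)%N) (T_ge1 : (1 <= T)%N)
  (rule : N.-tuple R -> N.-tuple (reward R S A) -> 'S_N)
  (ruleP : sorting_rule rule)
  (L : learners R S A) (L_meas : measurable_learners L)
  (C : nat -> R) (C_bound : cfr_regret_bound M L U C)
  (C_littleo : C =o_\oo (fun n : nat => n%:R : R))
  (d : measure_display) (Omega : measurableType d) (P : probability Omega R)
  (X : nat * 'I_N -> {RV P >-> reward R S A}) (X_iid : iid rho X)
  (pi : policy R S A) (p : R) (p_gt0 : 0 < p) (p_le1 : p <= 1) :
  let sample (w : Omega) (t : nat) : N.-tuple (reward R S A) :=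
    [tuple X (t, j) w | j < N] in
  let good := [set w | full_regret M k rule L rho (sample w) T pi
    <= C T / (1 - discount M) + 4 * U * Num.sqrt (2 * T%:R * ln (1 / p))] in
  measurable good /\ ((1 - p)%:E <= P good)%E.
Proof.
move=> sample good; set e := 4 * U * Num.sqrt _ in good *.
have mreg := measurable_full_regret M ruleP k_ge1 k_leN rho_bounded pi L_meas T
  (x := sample) (measurable_sample X).
have mgood : measurable good.
  rewrite (_ : good = (fun w => full_regret M k rule L rho (sample w) T pi) @^-1`
      `]-oo, C T / (1 - discount M) + e]%classic).
    by rewrite -[X in measurable X]setTI; exact: mreg.
  by apply/seteqP; split => w /=; rewrite in_itv.
split => //.
(* A set of probability 1 is nonempty, and a bounded reward forces [0 <= U] since states and actions
   exist. *)
have U_ge0 : 0 <= U.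
  have s := fdist_inhab (initial M); have a := fdist_inhab (pi s).
  have [[r rU]|noB] := pselect (exists r : reward R S A, reward_bounded U r).
    exact: le_trans (normr_ge0 _) (rU (s, a, s)).
  have B0 : [set r : reward R S A | reward_bounded U r] = set0.
    by apply/seteqP; split => // r rU; apply: noB; exists r.
  by move: rho_bounded; rewrite B0 measure0 => /eqP; rewrite eq_sym onee_eq0.
(* Rounds after [T] are included, as [cfr_regret_bound] takes infinite sequences of bounded rewards;
   a countable union of null sets is null. *)
have [N0 [mN0 PN0 N0P]] : {ae P, forall w, forall t i, reward_bounded U (X (t, i) w)}.
  have mB := @measurable_reward_bounded R S A U.
  apply: ae_foralln => t; apply: filter_forall => i.
  exists (X (t, i) @^-1` (~` [set r | reward_bounded U r])); split => //.
    by rewrite -[X in measurable X]setTI; apply: measurable_funP => //; exact: measurableC.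
  transitivity (rho (~` [set r | reward_bounded U r])).
    exact: X_iid.1 (t, i) _ (measurableC mB).
  by rewrite probability_setC // rho_bounded subee.
have regret w : ~ N0 w -> full_regret M k rule L rho (sample w) T pi <=
    C T / (1 - discount M) +
    total_noise M k rule L rho pi (fun=> [::]) (mkseq (sample w) T)
    /\ total_noise M k rule L rho pi (fun=> [::]) (mkseq (sample w) T) <= T%:R * (4 * U).
  move=> N0w; have wU t i : reward_bounded U (tnth (sample w t) i).
    rewrite tnth_mktuple; apply: contrapT => nU; apply: N0w; apply: N0P => /=.
    by move=> /(_ t i).
  split; first by apply: (@full_regret_le _ _ _ M k N rule ruleP L U C rho).
  by apply: (@total_noise_le _ _ _ M k N rule ruleP L U rho).
pose Bad : set (T.-tuple (N.-tuple (reward R S A))) := [set y |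
  (e < total_noise M k rule L rho pi (fun=> [::]) y)%R].
have mBad : measurable Bad.
  rewrite (_ : Bad = (fun y : T.-tuple _ => total_noise M k rule L rho pi (fun=> [::]) y)
      @^-1` `]e, +oo[%classic).
    rewrite -[X in measurable X]setTI; apply: measurable_total_noise => //.
    exact: measurable_history_cst.
  by apply/seteqP; split => y /=; rewrite in_itv /= andbT.
have samplesE w : samples X T w = mkseq (sample w) T :> seq _.
  by rewrite /samples /= /mkseq -val_enum_ord -map_comp.
have Pbad : (P (~` good) <= p%:E)%E.
  (* The parameter [l] of [noise_tail] divides by [U]; for [U = 0] the noise is nonpositive off
     [N0]. *)
  have [U0|U0] := eqVneq U 0.
    apply: (@le_trans _ _ (P N0)); last by rewrite PN0 lee_fin ltW.
    apply: le_measure; rewrite ?inE //; first exact: measurableC.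
    move=> w /= ngood; apply: contrapT => /regret [reg noise0]; apply: ngood.
    rewrite /good /=; apply: le_trans reg _; rewrite lerD2l.
    by apply: le_trans noise0 _; rewrite /e U0 !(mulr0, mul0r).
  have Up : 0 < U by rewrite lt_def U0.
  apply: (@le_trans _ _ (P (samples X T @^-1` Bad `|` N0))).
    apply: le_measure; rewrite ?inE.
    - exact: measurableC.
    - apply: measurableU => //; rewrite -[X in measurable X]setTI.
      exact: measurable_samples.
    move=> w /= ngood; have [|N0w] := pselect (N0 w); [by right | left].
    have [reg _] := regret w N0w; rewrite /Bad /= samplesE ltNge; apply/negP => tn.
    by apply: ngood; rewrite /good /=; apply: le_trans reg _; rewrite lerD2l.
  rewrite measureU0 //; last first.
    by rewrite -[X in measurable X]setTI; exact: measurable_samples.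
  apply: (@le_trans _ _ (power_prob (power_prob rho N) T Bad)).
    by rewrite -(law_samples X_iid mBad).
  exact: (noise_tail M ruleP k_ge1 k_leN rho_bounded pi L_meas).
have Pfin : P good \is a fin_num by exact: fin_num_measure.
move: Pbad; rewrite probability_setC // -(fineK Pfin) -EFinB !lee_fin; lra.
Qed.
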